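(* Let $Z_j$, for $1\le j\le s$, be compact LOTSes, and let $s=r+m$ where $r,m\ge 0$ are integers. For $r+1\le j\le s$, assume that $Z_j$ has either a strictly increasing or a strictly decreasing $\omega_1$-sequence. For $1\le j\le r$, assume that there is a countable $D_j\subseteq Z_j$ such that $\overline{D_j}$ is not scattered, and assume that at most one of the $\overline{D_j}$ $(1\le j\le r)$ is second countable. Then $\mathrm{Ldim}\bigl(\prod_{j=1}^s Z_j\bigr)=s$.
   Context: All spaces are Hausdorff. A LOTS is a totally ordered set with the order topology. A subset of a space is perfect iff it is closed, non-empty and has no isolated points; a space is scattered iff it has no perfect subsets. For a Tychonov space $X$, $\mathrm{Ldim}_0(X)$ is the least cardinal $\kappa$ such that $X$ is embeddable into a product of the form $\prod_{\alpha<\kappa}L_\alpha$, where each $L_\alpha$ is a LOTS (the empty product is a singleton). The LOTS dimension $\mathrm{Ldim}(X)$ is the least cardinal $\kappa$ such that every point of $X$ has a neighborhood $U$ with $\mathrm{Ldim}_0(\overline U)\le\kappa$. *)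

(* Defs.v *)
From mathcomp Require Export all_boot all_order.
From mathcomp Require Export all_classical.
From mathcomp Require Export topology.

Set Implicit Arguments.
Unset Strict Implicit.
Unset Printing Implicit Defensive.

Local Open Scope classical_set_scope.
Local Open Scope card_scope.

Definition perfect_subset (X : topologicalType) (P : set X) : Prop :=
  [/\ closed P, P !=set0 & isolated P = set0].

Definition scattered (X : topologicalType) : Prop :=
  forall P : set X, ~ perfect_subset P.

(* Homeomorphism onto the image: f is open as a map onto [range f]. *)
Definition embedding (X Y : topologicalType) (f : X -> Y) : Prop :=
  [/\ injective f, continuous f &
      forall U : set X, open U ->
        exists2 V : set Y, open V & f @` U = V `&` range f].

(* Cardinals are represented by types, compared through [#<=] on full sets. *)
Definition embeds_in_LOTS_product (X : topologicalType) (I : Type) : Prop :=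
  exists (d : Order.disp_t) (L : I -> orderTopologicalType d)
    (f : X -> prod_topology L), embedding f.

Definition Ldim0_is (X : topologicalType) (I : Type) : Prop :=
  embeds_in_LOTS_product X I /\
  forall J : Type, embeds_in_LOTS_product X J -> [set: I] #<= [set: J].

Definition Ldim0_le (X : topologicalType) (K : Type) : Prop :=
  exists2 I : Type, Ldim0_is X I & [set: I] #<= [set: K].

(* [set_type A] carries the subspace topology; the library's [subspace A]
   would add the points outside A as isolated points. *)
Definition locally_Ldim0_le (X : topologicalType) (K : Type) : Prop :=
  forall x : X, exists2 U : set X,
    nbhs x U & Ldim0_le (set_type (closure U)) K.

Definition Ldim_is (X : topologicalType) (K : Type) : Prop :=
  locally_Ldim0_le X K /\
  forall J : Type, locally_Ldim0_le X J -> [set: K] #<= [set: J].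

(* Order type omega_1: the uncountable well-orders with countable initial
   segments. *)
Definition is_omega1 (d : Order.disp_t) (W : orderType d) : Prop :=
  [/\ well_founded (fun a b : W => (a < b)%O),
      ~ countable [set: W] &
      forall b : W, countable [set a : W | (a < b)%O]].

Definition has_increasing_omega1_seq (d : Order.disp_t) (Z : orderType d) :
    Prop :=
  exists (d' : Order.disp_t) (W : orderType d') (f : W -> Z),
    is_omega1 W /\ forall a b : W, (a < b)%O -> (f a < f b)%O.

Definition has_decreasing_omega1_seq (d : Order.disp_t) (Z : orderType d) :
    Prop :=
  exists (d' : Order.disp_t) (W : orderType d') (f : W -> Z),
    is_omega1 W /\ forall a b : W, (a < b)%O -> (f b < f a)%O.

(* Main.v *)
Require Import Defs.
From mathcomp Require Import interval.

(** Suppose that a neighbourhood of a suitable point is mapped continuously into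
    k < r + m LOTSes. Take the point to be the limit of the omega_1-sequence in
    each of the last m coordinates, a point all of whose neighbourhoods contain
    uncountably many jumps where the closure of D_j is not second countable (a
    separable compact suborder with countably many jumps is second countable),
    and the limit of a monotone sequence in the at most one remaining coordinate.

    A map f : S x Y -> L into a LOTS, S separable, sees only one of the factors
    at generic places of Y. If Y carries an omega_1-sequence with limit o, then
    for club many limits e of its initial segments f(., e) is locally constant
    where f(., e) <> f(., o), because the points f(s, o) concerned have
    uncountable one-sided cofinality. If Y has uncountably many jumps lo < hi,
    then for all but countably many of them f(., lo) is locally constant where
    f(., lo) <> f(., hi), because a fixed countable set of values of f meets the
    gap ]f(s, lo), f(s, hi)[ for countably many jumps only. Picking generic
    places coordinate by coordinate gives a point at which each of the k maps
    sees at most one coordinate; some coordinate is then seen by none of them,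
    and the maps do not separate points. *)

Set Implicit Arguments.
Unset Strict Implicit.
Unset Printing Implicit Defensive.

Import Order.TTheory.

Local Open Scope order_scope.
Local Open Scope classical_set_scope.

(** * Continuous maps into linear orders *)

Section RayContinuity.
Context {d : Order.disp_t}.

(** Continuity for the order topology, phrased by rays so that it applies to a bare [orderType], in
    particular to a dual order. *)
Definition rcont (L : orderType d) (X : topologicalType) (f : X -> L) : Prop :=
  forall a, open [set x | f x < a] /\ open [set x | a < f x].

Lemma rcont_comp (L : orderType d) (X Y : topologicalType) (f : Y -> L)
  (h : X -> Y) : rcont f -> continuous h -> rcont (f \o h).
Proof.
move=> cf /continuousP ch a; have [? ?] := cf a.
by split; [apply: (ch [set x | f x < a])|apply: (ch [set x | a < f x])].
Qed.

(* [c] and [c'] are a common midpoint if there is one, [a] and [b] otherwise. *)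
Lemma lt_sep (L : orderType d) (a b : L) : a < b ->
  exists c c' : L, [/\ a < c', c < b & forall u v, u < c' -> c < v -> u < v].
Proof.
move=> ab; have [[r /andP[ar rb]]|nr] := pselect (exists r, a < r < b).
  by exists r, r; split=> // u v; exact: lt_trans.
exists a, b; split=> // u v ub av; apply/negPn/negP => uv; apply: nr.
rewrite -leNgt in uv; have [va|] := ltP v b; first by exists v; rewrite av.
by move=> bv; move: (lt_le_trans ub (le_trans bv uv)); rewrite ltxx.
Qed.

Lemma open_lt (L : orderType d) (X : topologicalType) (f h : X -> L) :
  rcont f -> rcont h -> open [set x | f x < h x].
Proof.
move=> cf ch; rewrite openE => x /= /lt_sep[c [c' [fc ch' H]]].
apply: (@filterS _ _ _ ([set x | f x < c'] `&` [set x | c < h x])).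
  by move=> y [] /= ? ?; exact: H.
apply: open_nbhs_nbhs; split=> //; apply: openI.
- exact: (cf c').1.
- exact: (ch c).2.
Qed.

Lemma open_neq (L : orderType d) (X : topologicalType) (f h : X -> L) :
  rcont f -> rcont h -> open [set x | f x != h x].
Proof.
move=> cf ch; rewrite (_ : mkset _ = [set x | f x < h x] `|` [set x | h x < f x]).
  by apply: openU; exact: open_lt.
apply/seteqP; split=> x /=; rewrite neq_lt; first by move/orP.
by case=> ->; rewrite ?orbT.
Qed.

End RayContinuity.

Lemma open_cst (X : topologicalType) (b : Prop) : open [set _ : X | b].
Proof. by rewrite openE => x /= hb; apply: filterS filterT => y _. Qed.

Lemma rcont_cst d (L : orderType d) (X : topologicalType) (c : L) :
  rcont (fun _ : X => c).
Proof. by move=> a; split; exact: open_cst. Qed.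

Lemma rcont_dual d (L : orderType d) (X : topologicalType) (f : X -> L) :
  rcont f -> @rcont (Order.dual_display d) L^d X f.
Proof. by move=> cf a; have [? ?] := cf a; split. Qed.

(** * Dense sequences, omega_1-nets and generic sequences *)

Definition dense_seq (X : topologicalType) (e : nat -> X) : Prop :=
  forall U : set X, open U -> U !=set0 -> exists n, U (e n).

Lemma dense_seq_const d (L : orderType d) (X : topologicalType) (e : nat -> X)
    (f : X -> L) (V : set X) (c : L) :
  dense_seq e -> rcont f -> open V -> (forall n, V (e n) -> f (e n) = c) ->
  forall x, V x -> f x = c.
Proof.
move=> de cf oV Vc x Vx; apply/eqP/negPn/negP => fx.
have /de : open (V `&` [set x | f x != c]).
  apply: openI => //; apply: (@open_neq _ _ _ f (fun=> c)) => //.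
  exact: rcont_cst.
case; first by exists x.
by move=> n [/Vc /= -> /eqP].
Qed.

(* [g] stands for a monotone omega_1-sequence converging to [o] and [lim al] for
   the limit of [g \o al]; [b0] is the index from which [g] stays in the
   neighbourhood of [o] under consideration. *)
Record omega1_net (Y : topologicalType) (dW : Order.disp_t) (W : orderType dW)
    (g : W -> Y) (o : Y) (lim : (nat -> W) -> Y) (b0 : W) : Prop := {
  on_bound : forall s : nat -> W, exists w, forall n, s n < w;
  on_cvg : forall N, nbhs o N -> exists b, forall a, b <= a -> N (g a);
  on_lim : forall al : nat -> W, (forall n, al n < al n.+1) -> b0 <= al 0%N ->
    forall N, nbhs (lim al) N -> exists n0, forall c, al n0 <= c ->
    (exists n, c < al n) -> N (g c);
  on_limlim : forall al : nat -> W, (forall n, al n < al n.+1) ->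
    b0 <= al 0%N -> forall N, nbhs (lim al) N ->
    exists n0, forall be : nat -> W, (forall n, be n < be n.+1) ->
    al n0 <= be 0%N -> (exists n, forall k, be k < al n) -> N (lim be);
  on_sep : forall al be : nat -> W, (forall n, al n < al n.+1) ->
    b0 <= al 0%N -> (forall n, be n < be n.+1) -> b0 <= be 0%N ->
    (exists n, forall k, be k < al n) -> lim be <> lim al }.

(** Replaces the choice of a limit from a club: [al] leaps over [H] at every step. For [H] with
    [a <= H a], a pointwise larger function asks for more, so several requirements are met by
    dominating their functions. *)
Definition generic (dW : Order.disp_t) (W : orderType dW) (b0 : W)
    (H : W -> W) (al : nat -> W) : Prop :=
  b0 <= al 0%N /\ forall n, al n <= H (al n) < al n.+1.

Definition left_uncountable d (L : orderType d) (p : L) : Prop :=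
  forall l : nat -> L, (forall n, l n < p) ->
  exists2 r, r < p & forall n, l n < r.

Lemma generic_mono dW (W : orderType dW) (b0 : W) H al :
  generic b0 H al -> forall n, al n < al n.+1.
Proof. by move=> [_ h] n; have /andP[] := h n; exact: le_lt_trans. Qed.

Lemma incr_le dW (W : orderType dW) (al : nat -> W) :
  (forall n, al n < al n.+1) -> forall m n, (m <= n)%N -> al m <= al n.
Proof.
move=> h m n; elim: n => [|n IH]; first by rewrite leqn0 => /eqP->.
rewrite leq_eqVlt => /predU1P[->//|]; rewrite ltnS => /IH /le_trans; apply.
exact: ltW.
Qed.

(** * Generic limits along an omega_1-net: one direction of the order *)

Section OmegaGeneric.
Context (S Y : topologicalType) (e : nat -> S) (de : dense_seq e).
Context (dW : Order.disp_t) (W : orderType dW) (g : W -> Y) (o : Y).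
Context (lim : (nat -> W) -> Y) (b0 : W) (net : omega1_net g o lim b0).

(** Countable subsets of [W] are bounded, so countably many upward closed conditions have a common
    witness. *)
Lemma omega1_bound (T : countType) (Q : T -> W -> Prop) :
  (forall t w w', w <= w' -> Q t w -> Q t w') -> (forall t, exists w, Q t w) ->
  exists w, forall t, Q t w.
Proof.
move=> mono /choice[h hQ].
pose s n := if unpickle n is Some t then h t else b0.
have [w sw] := on_bound net s.
exists w => t; apply: mono (hQ t); apply: ltW.
by have := sw (pickle t); rewrite /s pickleK.
Qed.

Lemma pair_continuousr (x : S) : continuous (fun y : Y => (x, y)).
Proof. by move=> y; apply: cvg_pair; [exact: cvg_cst|exact: cvg_id]. Qed.

Lemma pair_continuousl (y : Y) : continuous (fun x : S => (x, y)).
Proof. by move=> x; apply: cvg_pair; [exact: cvg_id|exact: cvg_cst]. Qed.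

Section Half.
Context (d : Order.disp_t) (L : orderType d) (f : S * Y -> L).
Hypothesis cf : rcont f.

Let phi n a := f (e n, g a).
Let P n := f (e n, o).
Let act n := forall b, exists2 c, b <= c & phi n c < P n.

(* On the dense sequence, the half-open intervals [f (x, lim al), f (x, o)) are
   pairwise equal or disjoint; this makes them locally constant in [x]. *)
Lemma generic_half : exists H : W -> W, forall H' : W -> W,
  (forall a, H a <= H' a) -> forall al, generic b0 H' al ->
  forall x, f (x, lim al) < f (x, o) ->
  [/\ exists2 V, open_nbhs x V & forall x', V x' -> f (x', lim al) = f (x, lim al),
      left_uncountable (f (x, o)) &
      forall be, generic b0 H' be -> f (x, lim be) < f (x, o)].
Proof.
have cfr x : rcont (fun y => f (x, y)).
  exact: (rcont_comp cf (@pair_continuousr x)).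
have cfl y : rcont (fun x => f (x, y)).
  exact: (rcont_comp cf (@pair_continuousl y)).
have phi_gt n r : r < P n -> exists b, forall c, b <= c -> r < phi n c.
  move=> rP; apply: (on_cvg net (N := [set y | r < f (e n, y)])).
  by apply: open_nbhs_nbhs; split; [exact: (cfr (e n) r).2|].
(* Past some index [b] the values [phi n] exceed all [l k], and activity of [n] yields such a value
   that is still below [P n]. *)
have actU n : act n -> left_uncountable (P n).
  move=> an l lP; have [b hb] : exists b, forall k, forall c, b <= c -> l k < phi n c.
    apply: omega1_bound => [k w w' ww' h c wc|k]; last exact: phi_gt.
    exact: h (le_trans ww' wc).
  by have [c bc cP] := an b; exists (phi n c) => // k; exact: hb.
(* The requirements on [w = H a]: witnesses for an active [n] occur between [a] and [w], and the
   eventual inequalities hold from [w] on. *)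
pose Q a (t : nat * nat) w := let: (n, m) := t in
  [/\ a <= w, act n -> P n = P m -> exists c c', [/\ a <= c < w, a <= c' < w,
        phi n c < P n & phi n c < phi m c'],
      ~ act n -> forall c, w <= c -> P n <= phi n c &
      P n < P m -> forall c, w <= c -> P n < phi m c].
have /choice[H HQ] : forall a, exists w, forall t, Q a t w.
  move=> a; apply: omega1_bound.
    move=> [n m] w w' ww' [aw h1 h2 h3]; split.
    - exact: le_trans ww'.
    - move=> an Pnm; have [c [c' [/andP[? cw] /andP[? c'w] ? ?]]] := h1 an Pnm.
      exists c, c'; split=> //; apply/andP; split=> //.
      + exact: lt_le_trans ww'.
      + exact: lt_le_trans ww'.
    - by move=> an c wc; apply: h2 => //; exact: le_trans wc.
    - by move=> an c wc; apply: h3 => //; exact: le_trans wc.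
  move=> [n m].
  have [w1 h1] : exists w, act n -> P n = P m -> exists c c',
      [/\ a <= c < w, a <= c' < w, phi n c < P n & phi n c < phi m c'].
    have [an|?] := pselect (act n); last by exists a.
    have [Pnm|?] := pselect (P n = P m); last by exists a.
    have [c ac cP] := an a; have [b hb] : exists b, forall c', b <= c' -> phi n c < phi m c'.
      by apply: phi_gt; rewrite -Pnm.
    have [w hw] := on_bound net (fun k => if k is 0%N then c else Order.max a b).
    exists w => _ _; exists c, (Order.max a b); split=> //.
    - by rewrite ac; exact: (hw 0%N).
    - by rewrite le_max lexx; exact: (hw 1%N).
    - by apply: hb; rewrite le_max lexx orbT.
  have [w2 h2] : exists w, ~ act n -> forall c, w <= c -> P n <= phi n c.
    have [an|an] := pselect (act n); first by exists a.
    have [b hb] : exists b, forall c, b <= c -> ~ (phi n c < P n).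
      apply: contrapT => h; apply: an => b; apply: contrapT => h'.
      apply: h; exists b => c bc cP; apply: h'; by exists c.
    by exists b => _ c /hb /negP; rewrite -leNgt.
  have [w3 h3] : exists w, P n < P m -> forall c, w <= c -> P n < phi m c.
    have [/phi_gt[b hb]|] := boolP (P n < P m); first by exists b.
    by exists a.
  pose w := Order.max (Order.max a w1) (Order.max w2 w3).
  exists w; rewrite /Q; split.
  - by rewrite /w !le_max lexx.
  - move=> an Pnm; have [c [c' [/andP[? cw] /andP[? c'w] ? ?]]] := h1 an Pnm.
    exists c, c'; split=> //; apply/andP; split=> //; rewrite lt_max ?lt_max ?cw ?c'w ?orbT//.
  - by move=> an c wc; apply: h2 => //; apply: le_trans wc; rewrite !le_max lexx !orbT.
  - by move=> an c wc; apply: h3 => //; apply: le_trans wc; rewrite !le_max lexx !orbT.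
exists H => H' HH'.
have genH al k : generic b0 H' al -> H (al k) < al k.+1.
  by move=> [_ h]; have /andP[_] := h k; exact: le_lt_trans.
have tail al (N : set Y) : generic b0 H' al -> nbhs (lim al) N ->
    exists k0, forall k c, (k0 <= k)%N -> al k <= c < H (al k) -> N (g c).
  move=> ga nN; have mal := generic_mono ga.
  have [k0 hk] := on_lim net mal ga.1 nN; exists k0 => k c k0k /andP[kc ck].
  apply: hk; first exact: le_trans (incr_le mal k0k) kc.
  by exists k.+1; exact: lt_trans (genH _ _ ga).
(* The index is positive so that [al k] lies beyond [H] of the preceding term. *)
have tail2 al (N : set Y) : generic b0 H' al -> nbhs (lim al) N ->
    exists2 k, (0 < k)%N & N (g (al k)).
  move=> ga nN; have mal := generic_mono ga.
  have [k0 hk] := on_lim net mal ga.1 nN; exists k0.+1 => //.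
  by apply: hk; [exact: ltW|exists k0.+2].
have nb_gt y x r : r < f (x, y) -> nbhs y [set y | r < f (x, y)].
  by move=> h; apply: open_nbhs_nbhs; split; [exact: (cfr x r).2|].
have nb_lt y x r : f (x, y) < r -> nbhs y [set y | f (x, y) < r].
  by move=> h; apply: open_nbhs_nbhs; split; [exact: (cfr x r).1|].
(* The facts [F1] to [F4] compare the values at [lim al] and at [o] along the dense sequence. In
   each, a strict inequality at [lim al] is pulled back to values [phi n c] that [Q] controls. *)
have F1 al n : generic b0 H' al -> f (e n, lim al) < P n -> act n.
  move=> ga h; apply: contrapT => na.
  have [[//|k] _ hk] := tail2 _ _ ga (nb_lt _ _ _ h).
  have [_ _ /(_ na) + _] := HQ (al k) (n, n).
  move=> /(_ (al k.+1) (ltW (genH _ _ ga))); rewrite leNgt => /negP; apply.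
  exact: hk.
have wit al n m : generic b0 H' al -> act n -> P n = P m ->
    exists cc : nat -> W * W, forall k, [/\ al k <= (cc k).1 < H (al k),
      al k <= (cc k).2 < H (al k), phi n (cc k).1 < P n &
      phi n (cc k).1 < phi m (cc k).2].
  move=> ga an Pnm; have /choice[cc hcc] : forall k, exists c : W * W,
    [/\ al k <= c.1 < H (al k), al k <= c.2 < H (al k), phi n c.1 < P n &
      phi n c.1 < phi m c.2]; last by exists cc.
  move=> k; have [_ /(_ an Pnm)[c [c' ?]] _ _] := HQ (al k) (n, m).
  by exists (c, c').
(* The witnesses give countably many values below [P n]; by uncountable cofinality they stay below
   some [r < P n], so the limit cannot reach [P n]. *)
have F2 al n : generic b0 H' al -> act n -> f (e n, lim al) < P n.
  move=> ga an; have [cc hcc] := wit al n n ga an erefl.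
  have [|r rP hr] := @actU n an (fun k => phi n (cc k).1).
    by move=> k; have [] := hcc k.
  rewrite ltNge; apply/negP => h.
  have [k0 hk] := tail _ _ ga (nb_gt _ _ _ (lt_le_trans rP h)).
  have [h1 _ _ _] := hcc k0; have := hk _ _ (leqnn k0) h1.
  by move/(lt_trans (hr k0)); rewrite /phi/= ltxx.
have F3 al n m : generic b0 H' al -> act n -> P n = P m ->
    f (e n, lim al) <= f (e m, lim al).
  move=> ga an Pnm; have [cc hcc] := wit al n m ga an Pnm.
  rewrite leNgt; apply/negP => /lt_sep[c [c' [h1 h2 h]]].
  have [k1 hk1] := tail _ _ ga (nb_gt _ _ _ h2).
  have [k2 hk2] := tail _ _ ga (nb_lt _ _ _ h1).
  pose k := maxn k1 k2; have [g1 g2 _ lt12] := hcc k.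
  suff : phi m (cc k).2 < phi n (cc k).1 by move/(lt_trans lt12); rewrite ltxx.
  apply: h.
  - by apply: (hk2 k) => //; rewrite leq_maxr.
  - by apply: (hk1 k) => //; rewrite leq_maxl.
have F4 al n m : generic b0 H' al -> P n < P m -> P n <= f (e m, lim al).
  move=> ga Pnm; rewrite leNgt; apply/negP => h.
  have [[//|k] _ hk] := tail2 _ _ ga (nb_lt _ _ _ h).
  have [_ _ _ /(_ Pnm)] := HQ (al k) (n, m); move/(_ (al k.+1) (ltW (genH _ _ ga))).
  by move/lt_trans => /(_ _ hk); rewrite ltxx.
(* On [V] every value at [lim al] lies below every value at [o]. Hence [F4] makes all [P n] with
   [e n] in [V] equal, [F3] used both ways does the same for the values at generic limits, and
   density extends this to [V]. *)
move=> al ga x xlt; have [c [c' [xc' cx sep]]] := lt_sep xlt.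
pose V := [set x' | f (x', lim al) < c'] `&` [set x' | c < f (x', o)].
have oV : open V by apply: openI; [exact: (cfl _ _).1|exact: (cfl _ _).2].
have Vx : V x by [].
have Vact n : V (e n) -> act n by move=> [? ?]; apply: (F1 al) => //; exact: sep.
have VP n m : V (e n) -> V (e m) -> P n = P m.
  move=> Vn Vm; apply/eqP; case: ltgtP => // h.
  - by move: (F4 al _ _ ga h); rewrite leNgt sep//; [case: Vm|case: Vn].
  - by move: (F4 al _ _ ga h); rewrite leNgt sep//; [case: Vn|case: Vm].
have Vq be n m : generic b0 H' be -> V (e n) -> V (e m) ->
    f (e n, lim be) = f (e m, lim be).
  move=> gb Vn Vm; apply/eqP; rewrite eq_le !F3//; try exact: VP; exact: Vact.
have [n Vn] := de oV (ex_intro _ x Vx).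
have Vo y : V y -> f (y, o) = P n.
  by apply: (@dense_seq_const _ _ _ _ (fun x => f (x, o)) V _ de) => // m Vm; exact: VP.
have Vl be y : generic b0 H' be -> V y -> f (y, lim be) = f (e n, lim be).
  move=> gb.
  by apply: (@dense_seq_const _ _ _ _ (fun x => f (x, lim be)) V _ de) => // m Vm; exact: Vq.
split.
- by exists V => // y Vy; rewrite !Vl.
- by rewrite Vo//; apply/actU/Vact.
- by move=> be gb; rewrite Vo// Vl//; apply: F2 => //; exact: Vact.
Qed.

End Half.
End OmegaGeneric.

(** * Convergent sequences, subspaces and pairs *)

Definition seq_cvg (X : topologicalType) (x : nat -> X) (b : X) : Prop :=
  forall N, nbhs b N -> exists k0, forall k, (k0 <= k)%N -> N (x k).

Section SetType.
Context (X : topologicalType) (A : set X).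

Lemma nbhs_set_type (x : A) (N : set A) : nbhs x N ->
  exists U : set X, [/\ open U, U (set_val x) & set_val @^-1` U `<=` N].
Proof. by case=> _ /= [] [U oU <- /= Ux sUN]; exists U. Qed.

Lemma set_val_continuous : continuous (set_val : A -> X).
Proof. exact: initial_continuous. Qed.

Definition to_set (x : X) (Ax : A x) : A := exist _ x (mem_set Ax).

Lemma to_setK (x : X) (Ax : A x) : set_val (to_set Ax) = x.
Proof. by []. Qed.

Lemma set_valP (x : A) : A (set_val x).
Proof. exact/set_mem/(valP x). Qed.

Lemma set_type_cvg (x : nat -> A) (b : A) :
  seq_cvg (set_val \o x) (set_val b) -> seq_cvg x b.
Proof.
move=> h N /nbhs_set_type[U [oU Ub UN]].
have [|k hk] := h U; first exact: open_nbhs_nbhs.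
by exists k => j kj; apply: UN; exact: hk.
Qed.

Lemma set_type_continuous (Y : topologicalType) (h : Y -> A) :
  continuous (set_val \o h) -> continuous h.
Proof. exact: continuous_comp_initial. Qed.

End SetType.

(** The subspace of [b] and the [x k] serves. It is countable, which keeps later products with
    separable spaces separable. *)
Lemma convergent_sequence_space (X : topologicalType) (x : nat -> X) (b : X) :
  seq_cvg x b -> (forall k, x k <> b) ->
  exists (C : topologicalType) (eC : nat -> C) (io : C -> X) (c : nat -> C) (c0 : C),
  [/\ forall z, exists n, eC n = z, continuous io, injective io,
      seq_cvg c c0 /\ (forall k, c k <> c0) &
      [/\ io c0 = b, forall k, io (c k) = x k & forall z, z = c0 \/ exists k, z = c k]].
Proof.
move=> cx xb; pose A := [set z | z = b \/ exists k, z = x k].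
have Ab : A b by left.
have Ax k : A (x k) by right; exists k.
exists (set_type A), (fun n => if n is k.+1 then to_set (Ax k) else to_set Ab).
exists set_val, (fun k => to_set (Ax k)), (to_set Ab); split=> //.
- move=> z; have [zb|[k zk]] := set_valP z.
    by exists 0%N; apply: val_inj.
  by exists k.+1; apply: val_inj.
- exact: set_val_continuous.
- split; first exact: set_type_cvg.
  by move=> k /(congr1 set_val); exact: xb.
- split=> // z; have [zb|[k zk]] := set_valP z; first by left; apply: val_inj.
  by right; exists k; apply: val_inj.
Qed.

Lemma surj_dense_seq (X : topologicalType) (e : nat -> X) :
  (forall x, exists n, e n = x) -> dense_seq e.
Proof. by move=> h U _ [x Ux]; have [n nx] := h x; exists n; rewrite nx. Qed.

Definition pair_seq (X Y : Type) (e : nat -> X) (e' : nat -> Y) (n : nat) : X * Y :=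
  if unpickle n is Some (i, j) then (e i, e' j) else (e 0%N, e' 0%N).

Lemma pair_seqE (X Y : Type) (e : nat -> X) (e' : nat -> Y) n :
  exists i j, pair_seq e e' n = (e i, e' j).
Proof.
rewrite /pair_seq; case: unpickle => [[i j]|]; first by exists i, j.
by exists 0%N, 0%N.
Qed.

Lemma pair_seq_surj (X Y : Type) (e : nat -> X) (e' : nat -> Y) :
  (forall x, exists n, e n = x) -> (forall x, exists n, e' n = x) ->
  forall x, exists n, pair_seq e e' n = x.
Proof.
move=> h h' [x y]; have [i <-] := h x; have [j <-] := h' y.
by exists (pickle (i, j)); rewrite /pair_seq pickleK.
Qed.

Lemma pair_seq_dense (X Y : topologicalType) (e : nat -> X) (e' : nat -> Y) :
  dense_seq e -> dense_seq e' -> dense_seq (pair_seq e e').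
Proof.
move=> h h' U oU [[x y] Uxy].
have : nbhs (x, y) U by exact: open_nbhs_nbhs.
case=> -[P Q] /= []; rewrite !nbhsE /= => -[P' [oP Px] PP] [Q' [oQ Qy] QQ] PQU.
have [i Pi] := h _ oP (ex_intro _ x Px).
have [j Qj] := h' _ oQ (ex_intro _ y Qy).
exists (pickle (i, j)); rewrite /pair_seq pickleK; apply: PQU.
by split; [exact: PP|exact: QQ].
Qed.

Lemma seq_cvg_pair (X Y : topologicalType) (x : nat -> X) (y : nat -> Y) a b :
  seq_cvg x a -> seq_cvg y b -> seq_cvg (fun k => (x k, y k)) (a, b).
Proof.
move=> cx cy N [[P Q]] /= [/cx[k1 h1] /cy[k2 h2]] PQN.
exists (maxn k1 k2) => k; rewrite geq_max => /andP[? ?].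
by apply: PQN; split; [exact: h1|exact: h2].
Qed.

Lemma seq_cvg_cst (X : topologicalType) (a : X) : seq_cvg (fun=> a) a.
Proof. by move=> N /nbhs_singleton Na; exists 0%N. Qed.

Lemma seq_cvg_shift (X : topologicalType) (x : nat -> X) (a : X) m :
  seq_cvg x a -> seq_cvg (fun k => x (m + k)%N) a.
Proof.
move=> cx N /cx[k hk]; exists k => j kj; apply: hk.
exact: leq_trans kj (leq_addl _ _).
Qed.

Lemma fin_eventually (T : finType) (Q : T -> nat -> Prop) :
  (forall t, exists k0, forall k, (k0 <= k)%N -> Q t k) ->
  exists k0, forall k, (k0 <= k)%N -> forall t, Q t k.
Proof.
move=> /choice[h hQ]; exists (\max_t h t) => k hk t; apply: hQ.
by apply: leq_trans hk; exact: leq_bigmax.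
Qed.

(** * Generic limits: both directions of the order *)

Section OmegaGenericFull.
Context (S Y : topologicalType) (e : nat -> S) (de : dense_seq e).
Context (dW : Order.disp_t) (W : orderType dW) (g : W -> Y) (o : Y).
Context (lim : (nat -> W) -> Y) (b0 : W) (net : omega1_net g o lim b0).

(** Apply [generic_half] to [f] and to its dual. The second clause holds because lying strictly
    below, or above, [f (x, o)] does not depend on the generic sequence; the third because countably
    many values on one side of a point cannot converge to it when the cofinality on that side is
    uncountable. *)
Lemma generic_limit (d : Order.disp_t) (L : orderType d) (f : S * Y -> L) :
  rcont f -> exists H : W -> W, forall H' : W -> W,
  (forall a, H a <= H' a) -> forall al, generic b0 H' al ->
  [/\ forall x, f (x, lim al) != f (x, o) -> exists2 V, open_nbhs x V &
        forall x', V x' -> f (x', lim al) = f (x, lim al),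
      forall x, f (x, lim al) = f (x, o) -> forall be, generic b0 H' be ->
        f (x, lim be) = f (x, o) &
      forall x xk, seq_cvg xk x -> f (x, lim al) = f (x, o) ->
        (forall k, f (xk k, o) = f (x, o)) ->
        exists k0, forall k, (k0 <= k)%N -> f (xk k, lim al) = f (x, lim al)].
Proof.
move=> cf; have [H1 h1] := generic_half de net cf.
have [H2 h2] := generic_half de net (rcont_dual cf).
exists (fun a => Order.max (H1 a) (H2 a)) => H' HH' al ga.
have {}h1 : forall al, generic b0 H' al ->
  forall x, f (x, lim al) < f (x, o) ->
  [/\ exists2 V, open_nbhs x V & forall x', V x' -> f (x', lim al) = f (x, lim al),
      left_uncountable (f (x, o)) &
      forall be, generic b0 H' be -> f (x, lim be) < f (x, o)].
  by apply: (h1 H') => a; apply: le_trans (HH' a); rewrite le_max lexx.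
have {}h2 : forall al, generic b0 H' al ->
  forall x, f (x, o) < f (x, lim al) ->
  [/\ exists2 V, open_nbhs x V & forall x', V x' -> f (x', lim al) = f (x, lim al),
      @left_uncountable (Order.dual_display d) L^d (f (x, o)) &
      forall be, generic b0 H' be -> f (x, o) < f (x, lim be)].
  by apply: (h2 H') => a; apply: le_trans (HH' a); rewrite le_max lexx orbT.
split.
- move=> x; rewrite neq_lt => /orP[]; first by move=> /(h1 _ ga)[].
  by move=> /(h2 _ ga)[].
- move=> x xo be gb; apply/eqP/negPn/negP; rewrite neq_lt => /orP[].
    by move=> /(h1 _ gb)[_ _ /(_ _ ga)]; rewrite xo ltxx.
  by move=> /(h2 _ gb)[_ _ /(_ _ ga)]; rewrite xo ltxx.
- move=> x xk cx xo xko.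
  have cfo : rcont (fun x => f (x, lim al)).
    exact: (rcont_comp cf (@pair_continuousl _ _ (lim al))).
  have [k1 hk1] : exists k1, forall k, (k1 <= k)%N -> ~~ (f (xk k, lim al) < f (x, o)).
    have [[j hj]|nj] := pselect (exists j, f (xk j, lim al) < f (x, o)); last first.
      by exists 0%N => k _; apply/negP => h; apply: nj; exists k.
    have lu : left_uncountable (f (x, o)).
      by move: hj; rewrite -(xko j) => /(h1 _ ga)[_ ? _].
    (* Terms that are not below [f (x, o)] are replaced by the [j]-th one, so that the whole
       sequence lies below. *)
    have [k|r rx hr] := lu (fun k => if f (xk k, lim al) < f (x, o)
        then f (xk k, lim al) else f (xk j, lim al)).
      by case: ifP.
    have [|k0 hk0] := cx [set x | r < f (x, lim al)].
      by apply: open_nbhs_nbhs; split; [exact: (cfo r).2|rewrite /= xo].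
    exists k0 => k /hk0 /= rk; apply/negP => h; have := hr k; rewrite h.
    by move/(lt_trans rk); rewrite ltxx.
  have [k2 hk2] : exists k1, forall k, (k1 <= k)%N -> ~~ (f (x, o) < f (xk k, lim al)).
    have [[j hj]|nj] := pselect (exists j, f (x, o) < f (xk j, lim al)); last first.
      by exists 0%N => k _; apply/negP => h; apply: nj; exists k.
    have lu : @left_uncountable (Order.dual_display d) L^d (f (x, o)).
      by move: hj; rewrite -(xko j) => /(h2 _ ga)[_ ? _].
    have [k|r rx hr] := lu (fun k => if f (x, o) < f (xk k, lim al)
        then f (xk k, lim al) else f (xk j, lim al)).
      by case: ifP.
    have [|k0 hk0] := cx [set x | f (x, lim al) < r].
      by apply: open_nbhs_nbhs; split; [exact: (cfo r).1|rewrite /= xo].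
    exists k0 => k /hk0 /= rk; apply/negP => h; have := hr k; rewrite h.
    by move=> rk'; have := @lt_trans d L _ _ _ rk rk'; rewrite ltxx.
  exists (maxn k1 k2) => k; rewrite geq_max => /andP[/hk1 h3 /hk2 h4].
  by apply/eqP; rewrite xo eq_le leNgt h4 leNgt h3.
Qed.

Lemma generic_exists (H : W -> W) : (forall a, a <= H a) ->
  forall b, b0 <= b -> exists2 al, generic b0 H al & b = al 0%N.
Proof.
move=> aH b b0b.
have /choice[nx hnx] : forall a, exists w, H a < w.
  by move=> a; have [w hw] := on_bound net (fun=> H a); exists w; exact: (hw 0%N).
by exists (fun n => iter n nx b) => //; split=> // n; rewrite aH hnx.
Qed.

(** Let [al] leap at each step over a whole generic sequence started at [al k]; the limits of these
    sequences are then squeezed towards [lim al]. *)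
Lemma generic_approx (H : W -> W) : (forall a, a <= H a) ->
  exists al (ak : nat -> nat -> W),
  [/\ generic b0 H al, forall k, generic b0 H (ak k),
      seq_cvg (fun k => lim (ak k)) (lim al) & forall k, lim (ak k) <> lim al].
Proof.
move=> aH.
have /choice[s hs] : forall b, exists al : nat -> W,
    b0 <= b -> generic b0 H al /\ b = al 0%N.
  move=> b; have [b0b|?] := boolP (b0 <= b); last by exists (fun=> b0).
  by have [al ? ?] := generic_exists aH b0b; exists al.
have /choice[u hu] : forall b, exists w, forall n, s b n < w.
  by move=> b; exact: (on_bound net).
pose H2 a := Order.max (H a) (u a).
have [al ga _] : exists2 al, generic b0 H2 al & b0 = al 0%N.
  by apply: generic_exists => // a; rewrite /H2 le_max aH.
have mal := generic_mono ga.
have b0al k : b0 <= al k by exact: le_trans ga.1 (incr_le mal (leq0n k)).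
have gH : generic b0 H al.
  split; first exact: ga.1.
  by move=> n; rewrite aH /=; have /andP[_] := ga.2 n; rewrite /H2 gt_max => /andP[].
have gk k : generic b0 H (s (al k)) by have [] := hs _ (b0al k).
have s0 k : s (al k) 0%N = al k by have [_ <-] := hs _ (b0al k).
have sb k : exists n, forall j, s (al k) j < al n.
  exists k.+1 => j; apply: lt_trans (hu _ j) _.
  by have /andP[_] := ga.2 k; rewrite /H2 gt_max => /andP[].
exists al, (fun k => s (al k)); split=> //.
- move=> N nN; have [n0 hn] := on_limlim net mal ga.1 nN.
  exists n0 => k n0k; apply: hn => //; first exact: generic_mono (gk k).
  by rewrite s0; exact: incr_le.
- move=> k; apply: (on_sep net mal ga.1 (generic_mono (gk k))) => //.
  exact: (gk k).1.
Qed.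

Lemma generic_family (d : Order.disp_t) (I : finType) (L : I -> orderType d)
    (f : forall i, S * Y -> L i) : (forall i, rcont (f i)) ->
  exists al (ak : nat -> nat -> W),
  [/\ seq_cvg (fun k => lim (ak k)) (lim al), forall k, lim (ak k) <> lim al &
   forall i, [/\ forall x, f i (x, lim al) != f i (x, o) -> exists2 V, open_nbhs x V &
        forall x', V x' -> f i (x', lim al) = f i (x, lim al),
      forall x, f i (x, lim al) = f i (x, o) -> forall k,
        f i (x, lim (ak k)) = f i (x, o) &
      forall x xk, seq_cvg xk x -> f i (x, lim al) = f i (x, o) ->
        (forall k, f i (xk k, o) = f i (x, o)) ->
        exists k0, forall k, (k0 <= k)%N -> f i (xk k, lim al) = f i (x, lim al)]].
Proof.
move=> cf; have /choice[Hi hi] := fun i => generic_limit (cf i).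
(* The extra index [None] provides [a <= H a], as [generic_approx] demands. *)
have /choice[H hH] : forall a, exists w, forall t : option I,
    (if t is Some i then Hi i a else a) <= w.
  move=> a; apply: (omega1_bound net) => [t w w' ww' h|t].
    exact: le_trans ww'.
  by exists (if t is Some i then Hi i a else a).
have [al [ak [ga gk ck nk]]] := generic_approx (fun a => hH a None).
exists al, ak; split=> // i.
have [h1 h2 h3] := hi i H (fun a => hH a (Some i)) al ga.
by split=> // x xo k; exact: h2.
Qed.

End OmegaGenericFull.

(** * Cores built from omega_1-nets *)

Lemma continuous_pair (X Y Z : topologicalType) (f : X -> Y) (h : X -> Z) :
  continuous f -> continuous h -> continuous (fun x => (f x, h x)).
Proof. by move=> cf ch x; apply: cvg_pair; [exact: cf|exact: ch]. Qed.

Lemma continuous_fst (X Y : topologicalType) : continuous (fst : X * Y -> X).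
Proof. by move=> x; exact: cvg_fst. Qed.

Lemma continuous_snd (X Y : topologicalType) : continuous (snd : X * Y -> Y).
Proof. by move=> x; exact: cvg_snd. Qed.

Lemma continuous_compose (X Y Z : topologicalType) (f : Y -> Z) (h : X -> Y) :
  continuous f -> continuous h -> continuous (fun x => f (h x)).
Proof. by move=> cf ch x; apply: continuous_comp; [exact: ch|exact: cf]. Qed.

Definition point_space : topologicalType := initial_topology (fun _ : unit => 0%N).

Definition omega1_space (Y : topologicalType) : Prop :=
  exists (dW : Order.disp_t) (W : orderType dW) (g : W -> Y) (o : Y)
    (lim : (nat -> W) -> Y) (b0 : W), omega1_net g o lim b0.

(** The counting device: fewer than [n] maps always leave some sequence undetected. The sequence may
    depend on [s] and on [K], since which maps see a coordinate varies with the point. *)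
Definition stationary (S B : topologicalType) (b0 : B) (d : Order.disp_t) (k : nat)
    (L : 'I_k -> orderType d) (f : forall i, S * B -> L i) (n : nat) : Prop :=
  forall s (K : {set 'I_k}), (#|K| < n)%N -> exists x : nat -> B,
  [/\ seq_cvg x b0, forall j, x j <> b0 &
      forall i, i \in K -> forall j, f i (s, x j) = f i (s, b0)].

(** The space [B] is chosen before the point [s], which is fixed only later by the jump coordinates;
    countability of [B] keeps [S * B] separable. *)
Definition omega1_core (A : topologicalType) (n : nat) : Prop :=
  forall (d : Order.disp_t) (S : topologicalType) (e : nat -> S), dense_seq e ->
  forall k (L : 'I_k -> orderType d) (f : forall i, S * A -> L i),
  (forall i, rcont (f i)) ->
  exists (B : topologicalType) (eB : nat -> B) (io : B -> A) (b0 : B),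
  [/\ forall b, exists n, eB n = b, continuous io, injective io &
      stationary b0 (fun i x => f i (x.1, io x.2)) n].

Lemma omega1_core_point : omega1_core point_space 0%N.
Proof.
move=> d S e de k L f cf; exists point_space, (fun=> tt), id, tt; split=> //.
- by case; exists 0%N.
- by move=> x; exact: cvg_id.
Qed.

Lemma omega1_core_sequence (C : topologicalType) (eC : nat -> C) (c : nat -> C) (c0 : C) :
  (forall z, exists n, eC n = z) -> seq_cvg c c0 -> (forall k, c k <> c0) ->
  omega1_core C 1%N.
Proof.
move=> hC cc nc d S e de k L f cf; exists C, eC, id, c0; split=> //.
  by move=> x; exact: cvg_id.
move=> s K; rewrite ltnS leqn0 cards_eq0 => /eqP->; exists c; split=> // i.
by rewrite inE.
Qed.

(** At [(s, b0)] a map in [K] either has equal values at [lim al] and [o], and then keeps this value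
    at all [lim (ak k)], or it is locally constant in the other coordinates at [lim al]. If all maps
    are of the first kind, move in [Y]; otherwise fewer than [n] of them are, and the core [A], cut
    down on the slice over [o], provides the sequence. *)
Lemma omega1_core_prod (A Y : topologicalType) (n : nat) :
  omega1_core A n -> omega1_space Y -> omega1_core (A * Y)%type n.+1.
Proof.
move=> cA [dW [W [g [o [lim [w0 net]]]]]] d S e de k L f cf.
have [|B [eB [io [b0 [sB cio iio st]]]]] := cA d S e de k L
    (fun i x => f i (x.1, (x.2, o))).
  move=> i; apply: (rcont_comp (cf i)).
  apply: continuous_pair; first exact: continuous_fst.
  by apply: continuous_pair; [exact: continuous_snd|exact: cst_continuous].
pose F i (x : S * B * Y) := f i (x.1.1, (io x.1.2, x.2)).
have cF i : rcont (F i).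
  apply: (rcont_comp (cf i)).
  apply: continuous_pair.
    by apply: continuous_compose; exact: continuous_fst.
  apply: continuous_pair; last exact: continuous_snd.
  apply: continuous_compose => //.
  by apply: continuous_compose; [exact: continuous_snd|exact: continuous_fst].
have [al [ak [ca na hF]]] :=
  generic_family (pair_seq_dense de (surj_dense_seq sB)) net cF.
have [C [eC [jo [c [c0 [sC cjo ijo [cc nc] [jc0 jc _]]]]]]] :=
  convergent_sequence_space ca na.
exists (B * C)%type, (pair_seq eB eC), (fun x => (io x.1, jo x.2)), (b0, c0); split.
- exact: pair_seq_surj.
- apply: continuous_pair; apply: continuous_compose => //.
  + exact: continuous_fst.
  + exact: continuous_snd.
- by move=> [x y] [x' y'] /= [/iio -> /ijo ->].
move=> s K; rewrite ltnS => Kn.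
pose K0 := [set i in K | F i ((s, b0), lim al) == F i ((s, b0), o)].
have [K0K|K0K] := eqVneq K0 K.
  exists (fun j => (b0, c j)); split.
  - exact: (seq_cvg_pair (@seq_cvg_cst _ b0)).
  - by move=> j [/nc].
  - move=> i; rewrite -{1}K0K inE => /andP[_ /eqP Fi] j /=; rewrite jc jc0.
    have [_ h2 _] := hF i.
    by rewrite -/(F i ((s, b0), lim (ak j))) (h2 _ Fi) -Fi.
have K0s : K0 \subset K by apply/fintype.subsetP => i; rewrite inE => /andP[].
have K0n : (#|K0| < n)%N.
  by apply: leq_trans Kn; apply: proper_card; rewrite finset.properEneq K0K.
have [x [cx nx hx]] := st s K0 K0n.
have cx' : seq_cvg (fun j => (s, x j)) (s, b0).
  exact: (seq_cvg_pair (@seq_cvg_cst _ s)).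
have [i|m hm] := @fin_eventually 'I_k (fun i j => i \in K ->
    F i ((s, x j), lim al) = F i ((s, b0), lim al)).
  have [h1 _ h3] := hF i.
  have [Fi|Fi] := eqVneq (F i ((s, b0), lim al)) (F i ((s, b0), o)); last first.
    have [V Vb hV] := h1 _ Fi.
    have [j0 hj] := cx' V (open_nbhs_nbhs Vb).
    by exists j0 => j /hj Vj _; exact: hV.
  have [iK|iK] := boolP (i \in K); last by exists 0%N.
  (* Maps in [K0] are constant along [x] on the slice over [o]; the third clause carries this over
     to the slice over [lim al]. *)
  have [|j0 hj] := h3 _ _ cx' Fi; last by exists j0 => j /hj.
  by move=> j; apply: hx; rewrite inE iK Fi eqxx.
exists (fun j => (x (m + j)%N, c0)); split.
- exact: seq_cvg_pair (seq_cvg_shift _ cx) (@seq_cvg_cst _ c0).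
- by move=> j [/nx].
- by move=> i iK j /=; rewrite jc0; apply: (hm (m + j)%N) => //; exact: leq_addr.
Qed.

(** * Generic choice of a jump *)

(* [lo y < hi y] are the two sides of a jump, and [nb c y] is the trace of
   ]eY c, lo y]; two such left neighbourhoods with the same left end [eY c] are
   nested, and the larger one contains both sides of the smaller jump. *)
Definition jump_space (Y : topologicalType) : Prop :=
  exists (eY : nat -> Y) (J : Type) (lo hi : J -> Y) (nb : nat -> J -> set Y),
  [/\ dense_seq eY, ~ countable [set: J], forall y, lo y <> hi y,
      forall y N, nbhs (lo y) N -> exists2 c, nb c y (lo y) & nb c y `<=` N &
      forall c y y', nb c y (lo y) -> nb c y' (lo y') -> y <> y' ->
        (nb c y' (lo y) /\ nb c y' (hi y)) \/ (nb c y (lo y') /\ nb c y (hi y'))].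

(** Asymmetric: only [p], the value on the side [lo] that is kept, has to be locally constant where
    the two sides are told apart. *)
Definition good_pair (d : Order.disp_t) (L : orderType d) (A : topologicalType)
    (p q : A -> L) : Prop :=
  forall a, p a != q a -> exists2 V, open_nbhs a V & forall a', V a' -> p a' = p a.

(** Otherwise choosing a bad [t] for each [y] would inject [J] into a countable type. *)
Lemma uncountable_avoid (J : Type) (T : countType) (Bad : J -> T -> Prop) :
  ~ countable [set: J] -> (forall t y y', Bad y t -> Bad y' t -> y = y') ->
  exists y, forall t, ~ Bad y t.
Proof.
move=> nJ inj; apply: contrapT => h; apply: nJ.
have /choice[u hu] : forall y, exists t, Bad y t.
  move=> y; apply: contrapT => h'; apply: h; exists y => t b; apply: h'.
  by exists t.
apply/countable_injP; exists (pickle \o u) => y y' _ _ /= /(pcan_inj pickleK) uy.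
by apply: (inj (u y)) => //; rewrite uy.
Qed.

(* No value of [f] lies strictly between [f (a, lo)] and [f (a, hi)], so a nearby
   pair [f (a', lo)], [f (a', hi)] can only be the same pair. *)
Lemma gap_good_half (d : Order.disp_t) (L : orderType d) (A Y : topologicalType)
    (e : nat -> A) (eY : nat -> Y) (f : A * Y -> L) (lo hi : Y) :
  dense_seq e -> dense_seq eY -> rcont f ->
  (forall n n' m, ~ (f (e n, lo) < f (e n', eY m) < f (e n, hi))) ->
  forall a, f (a, lo) < f (a, hi) ->
  exists2 V, open_nbhs a V & forall a', V a' -> f (a', lo) = f (a, lo).
Proof.
move=> de deY cf gapQ a alt.
have cfl y : rcont (fun x => f (x, y)).
  exact: (rcont_comp cf (@pair_continuousl _ _ y)).
(* Density and continuity extend the gap condition from the two sequences to all points. *)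
have gap b x : ~ (f (b, lo) < f x < f (b, hi)).
  move=> /andP[h1 h2].
  have [||n []] := pair_seq_dense de deY
      (U := [set x | f (b, lo) < f x] `&` [set x | f x < f (b, hi)]).
  - by apply: openI; [exact: (cf _).2|exact: (cf _).1].
  - by exists x.
  have [i [j ->]] := pair_seqE e eY n => /= h3 h4.
  have [||m []] := de ([set x | f (x, lo) < f (e i, eY j)] `&`
      [set x | f (e i, eY j) < f (x, hi)]).
  - by apply: openI; [exact: (cfl _ _).1|exact: (cfl _ _).2].
  - by exists b.
  by move=> /= h5 h6; apply: (gapQ m i j); rewrite h5.
exists ([set x | f (x, lo) < f (a, hi)] `&` [set x | f (a, lo) < f (x, hi)]).
  by split=> //; apply: openI; [exact: (cfl _ _).1|exact: (cfl _ _).2].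
move=> x [/= h1 h2]; apply/eqP; case: ltgtP => // h3.
- by case: (gap x (a, lo)); rewrite h3.
- by case: (gap a (x, lo)); rewrite h3.
Qed.

Lemma gap_good (d : Order.disp_t) (L : orderType d) (A Y : topologicalType)
    (e : nat -> A) (eY : nat -> Y) (f : A * Y -> L) (lo hi : Y) :
  dense_seq e -> dense_seq eY -> rcont f ->
  (forall n n' m, ~ (f (e n, lo) < f (e n', eY m) < f (e n, hi))) ->
  (forall n n' m, ~ (f (e n, hi) < f (e n', eY m) < f (e n, lo))) ->
  good_pair (fun a => f (a, lo)) (fun a => f (a, hi)).
Proof.
move=> de deY cf h1 h2 a; rewrite neq_lt => /orP[]; first exact: gap_good_half h1 a.
apply: (gap_good_half de deY (rcont_dual cf)) => n n' m /andP[h3 h4].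
by apply: (h2 n n' m); apply/andP; split; [exact: h4|exact: h3].
Qed.

Section JumpGeneric.
Context (A Y : topologicalType) (e : nat -> A) (eY : nat -> Y).
Context (de : dense_seq e) (deY : dense_seq eY).
Context (J : Type) (lo hi : J -> Y) (nb : nat -> J -> set Y).
Hypothesis nJ : ~ countable [set: J].
Hypothesis nbP : forall y N, nbhs (lo y) N -> exists2 c, nb c y (lo y) & nb c y `<=` N.
Hypothesis nb_cross : forall c y y', nb c y (lo y) -> nb c y' (lo y') -> y <> y' ->
  (nb c y' (lo y) /\ nb c y' (hi y)) \/ (nb c y (lo y') /\ nb c y (hi y')).

(** Every failure of a jump is witnessed by a datum from a countable type, and one datum serves at
    most one jump; since [J] is uncountable, some jump has no failure. The second clause says that
    crossing the new jump leaves the earlier pairs undisturbed. *)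
Lemma jump_generic (d : Order.disp_t) (I I' : finType) (L : I -> orderType d)
    (M : I' -> orderType d) (f : forall i, A * Y -> L i) (p q : forall l, A * Y -> M l) :
  (forall i, rcont (f i)) -> (forall l, rcont (p l)) -> (forall l, rcont (q l)) ->
  (forall l, good_pair (p l) (q l)) ->
  exists y, (forall i, good_pair (fun a => f i (a, lo y)) (fun a => f i (a, hi y))) /\
   (forall l a, p l (a, lo y) != q l (a, lo y) -> p l (a, hi y) = p l (a, lo y)).
Proof.
move=> cf cp cq gpq.
pose T : countType := ((I * nat * nat * nat * nat * bool) + (I' * nat * nat))%type.
(* A left datum is a value [r] strictly between the two sides, with a left neighbourhood where
   [f i (e n, .)] stays on the same side of [r] as at [lo y]; [b] tells whether [f i] rises across
   the jump. A right datum says that [p l (e n, .)] is constant on the neighbourhood but changes at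
   [hi y]. *)
pose Bad y (t : T) := match t with
  | inl (i, n, n', m, c, b) => let r := f i (e n', eY m) in nb c y (lo y) /\
      (if b then f i (e n, lo y) < r < f i (e n, hi y) /\
                 forall z, nb c y z -> f i (e n, z) < r
       else f i (e n, hi y) < r < f i (e n, lo y) /\
                 forall z, nb c y z -> r < f i (e n, z))
  | inr (l, n, c) => [/\ nb c y (lo y), p l (e n, hi y) != p l (e n, lo y) &
      forall z, nb c y z -> p l (e n, z) = p l (e n, lo y)]
  end.
have cr i x : rcont (fun y => f i (x, y)).
  exact: (rcont_comp (cf i) (@pair_continuousr _ _ x)).
have clp l y : rcont (fun x => p l (x, y)).
  exact: (rcont_comp (cp l) (@pair_continuousl _ _ y)).
have clq l y : rcont (fun x => q l (x, y)).
  exact: (rcont_comp (cq l) (@pair_continuousl _ _ y)).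
(* For two jumps with equal data, [nb_cross] puts both sides of one into the neighbourhood of the
   other, where the datum excludes its [hi]. *)
have [|y hy] := @uncountable_avoid J T Bad nJ.
  case=> [[[[[[i n] n'] m] c] b]|[[l n] c]] y y' /=.
    move=> [h1 h2] [h1' h2']; apply: contrapT => /(nb_cross h1 h1').
    case: b h2 h2' => -[/andP[g1 g2] g3] [/andP[g1' g2'] g3'].
      case=> [[_ /g3']|[_ /g3]] h.
      - by move: (lt_trans h g2); rewrite ltxx.
      - by move: (lt_trans h g2'); rewrite ltxx.
    case=> [[_ /g3']|[_ /g3]] h.
    - by move: (lt_trans h g1); rewrite ltxx.
    - by move: (lt_trans h g1'); rewrite ltxx.
  move=> [h1 h2 h3] [h1' h2' h3']; apply: contrapT => /(nb_cross h1 h1').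
  case=> [[/h3' g1 /h3' g2]|[/h3 g1 /h3 g2]].
  - by move: h2; rewrite g1 g2 eqxx.
  - by move: h2'; rewrite g1 g2 eqxx.
exists y; split=> [i|l a plq].
  apply: (gap_good de deY (cf i)) => n n' m h.
    have [|c c1 c2] := nbP (y := y) (N := [set z | f i (e n, z) < f i (e n', eY m)]).
      by apply: open_nbhs_nbhs; split; [exact: (cr _ _ _).1|case/andP: h].
    by apply: (hy (inl (i, n, n', m, c, true))).
  have [|c c1 c2] := nbP (y := y) (N := [set z | f i (e n', eY m) < f i (e n, z)]).
    by apply: open_nbhs_nbhs; split; [exact: (cr _ _ _).2|case/andP: h].
  by apply: (hy (inl (i, n, n', m, c, false))).
(* Near [(e n, lo y)] the map [p l] is constant, so a change at [hi y] would be a right datum. Both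
   inequalities are open, hence density then covers every [a]. *)
have main n : p l (e n, lo y) != q l (e n, lo y) -> p l (e n, hi y) = p l (e n, lo y).
  move=> pn; apply/eqP/negPn/negP => ne; have [V [oV Vx] hV] := gpq l _ pn.
  have [|c c1 c2] := nbP (y := y) (N := [set z | V (e n, z)]).
    apply: open_nbhs_nbhs; split=> //.
    by move/continuousP: (@pair_continuousr A Y (e n)) => /(_ _ oV).
  by apply: (hy (inr (l, n, c))); split=> // z /c2 /= ?; exact: hV.
apply/eqP/negPn/negP => ne.
have [||n [/= h1 h2]] := de (U := [set a | p l (a, lo y) != q l (a, lo y)] `&`
    [set a | p l (a, hi y) != p l (a, lo y)]).
- by apply: openI; exact: open_neq.
- by exists a.
by move: h2; rewrite main ?eqxx.
Qed.

End JumpGeneric.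

(** * Cores built from jumps *)

(* The pairs [p l, q l] record the values of a map at the two sides of the jumps
   chosen so far in other coordinates. *)
Definition jump_core (S : topologicalType) (n : nat) : Prop :=
  (exists e : nat -> S, dense_seq e) /\
  forall (d : Order.disp_t) (B : topologicalType) (eB : nat -> B) (b0 : B),
  (forall b, exists n, eB n = b) ->
  forall k N (L : 'I_k -> orderType d) (f : forall i, S * B -> L i),
  (forall i, rcont (f i)) -> stationary b0 f N ->
  forall (I : finType) (M : I -> orderType d) (p q : forall l, S * B -> M l),
  (forall l, rcont (p l)) -> (forall l, rcont (q l)) ->
  (forall l, good_pair (p l) (q l)) ->
  exists s, forall K : {set 'I_k}, (#|K| < N + n)%N -> exists x,
  [/\ x <> (s, b0), forall i, i \in K -> f i x = f i (s, b0) &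
      forall l, p l (s, b0) != q l (s, b0) -> p l x = p l (s, b0)].

Lemma jump_core_point : jump_core point_space 0%N.
Proof.
split; first by exists (fun=> tt); apply: surj_dense_seq; case; exists 0%N.
move=> d B eB b0 sB k N L f cf st I M p q cp cq gpq.
exists tt => K; rewrite addn0 => /(st tt)[x [cx nx hx]].
have [l|m hm] := @fin_eventually I (fun l j => p l (tt, b0) != q l (tt, b0) ->
    p l (tt, x j) = p l (tt, b0)).
  have [pq|pq] := boolP (p l (tt, b0) != q l (tt, b0)); last by exists 0%N.
  have [V Vb hV] := gpq l _ pq.
  have [|j0 hj] := seq_cvg_pair (@seq_cvg_cst point_space tt) cx (N := V).
    exact: open_nbhs_nbhs.
  by exists j0 => j /hj ? _; exact: hV.
exists (tt, x m); split.
- by move=> [/nx].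
- by move=> i iK; exact: hx.
- by move=> l; exact: (hm m (leqnn m)).
Qed.

(** Take a generic jump [y] and use the core [S] on the slice over [lo y]. If no map in [K]
    distinguishes the two sides at the resulting point, cross to [hi y]; otherwise the maps that do
    distinguish them are held fixed by their recorded pairs, and strictly fewer are left for [S]. *)
Lemma jump_core_prod (S Y : topologicalType) (n : nat) :
  jump_core S n -> jump_space Y -> jump_core (S * Y)%type n.+1.
Proof.
move=> [[e de] cS] [eY [J [lo [hi [nb [deY nJ lohi nbP nbX]]]]]].
split; first by exists (pair_seq e eY); exact: pair_seq_dense.
move=> d B eB b0 sB k N L f cf st I M p q cp cq gpq.
pose sw (x : S * B * Y) : S * Y * B := ((x.1.1, x.2), x.1.2).
have csw : continuous sw.
  apply: continuous_pair; [apply: continuous_pair|].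
  - by apply: continuous_compose; exact: continuous_fst.
  - exact: continuous_snd.
  - by apply: continuous_compose; [exact: continuous_snd|exact: continuous_fst].
have good_sw (A A' : topologicalType) (h : A' -> A) dM (M' : orderType dM) (p' q' : A -> M') :
    continuous h -> good_pair p' q' -> good_pair (p' \o h) (q' \o h).
  move=> ch g x /= /g[V [oV Vx] hV]; exists (h @^-1` V); last by move=> ? /hV.
  by split=> //; move/continuousP: ch; exact.
have [||||y [hy1 hy2]] := @jump_generic (S * B)%type Y (pair_seq e eB) eY
    (pair_seq_dense de (surj_dense_seq sB)) deY J lo hi nb nJ nbP nbX d 'I_k I L M
    (fun i => f i \o sw) (fun l => p l \o sw) (fun l => q l \o sw).
- by move=> i; exact: rcont_comp.
- by move=> i; exact: rcont_comp.
- by move=> i; exact: rcont_comp.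
- by move=> l; exact: good_sw.
pose at_ (z : Y) (x : S * B) : S * Y * B := ((x.1, z), x.2).
have cat z : continuous (at_ z).
  apply: continuous_pair; [apply: continuous_pair|].
  - exact: continuous_fst.
  - exact: cst_continuous.
  - exact: continuous_snd.
(* The two sides of the new jump turn each [f i] into a recorded pair; the older pairs are
   restricted to [lo y]. *)
pose M' (l : 'I_k + I) : orderType d := match l with inl i => L i | inr l => M l end.
pose p' (l : 'I_k + I) : S * B -> M' l :=
  match l return S * B -> M' l with inl i => f i \o at_ (lo y) | inr l => p l \o at_ (lo y) end.
pose q' (l : 'I_k + I) : S * B -> M' l :=
  match l return S * B -> M' l with inl i => f i \o at_ (hi y) | inr l => q l \o at_ (lo y) end.
have [|||||s hs] := cS d B eB b0 sB k N L (fun i => f i \o at_ (lo y)) _ _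
   ('I_k + I)%type M' p' q'.
- by move=> i; exact: rcont_comp.
- by move=> s K KN; exact: (st (s, lo y) K KN).
- by case=> i; [exact: (rcont_comp (cf i) (cat _))|exact: (rcont_comp (cp i) (cat _))].
- by case=> i; [exact: (rcont_comp (cf i) (cat _))|exact: (rcont_comp (cq i) (cat _))].
- by case=> i; [exact: hy1|exact: (good_sw _ _ _ _ _ _ _ (cat (lo y)) (gpq i))].
exists (s, lo y) => K; rewrite addnS ltnS => Kn.
pose K0 := [set i in K | f i ((s, lo y), b0) == f i ((s, hi y), b0)].
have [K0K|K0K] := eqVneq K0 K.
  exists ((s, hi y), b0); split.
  - by move=> [/esym /lohi].
  - by move=> i; rewrite -K0K inE => /andP[_ /eqP].
  - by move=> l; exact: (hy2 l (s, b0)).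
have K0s : K0 \subset K by apply/fintype.subsetP => i; rewrite inE => /andP[].
have K0n : (#|K0| < N + n)%N.
  by apply: leq_trans Kn; apply: proper_card; rewrite finset.properEneq K0K.
have [[s' b] [nx hx hp]] := hs K0 K0n.
exists ((s', lo y), b); split.
- by move=> [? ?]; apply: nx; congr pair.
- move=> i iK; have [fi|fi] := eqVneq (f i ((s, lo y), b0)) (f i ((s, hi y), b0)).
    by apply: hx; rewrite inE iK fi eqxx.
  exact: (hp (inl i)).
- by move=> l; exact: (hp (inr l)).
Qed.

(** * Orders up to reversal *)

Section SignedOrder.
Context (d : Order.disp_t) (T : orderType d) (s : bool).
Implicit Types x y z : T.

(** A false [s] reverses the order, so that increasing and decreasing sequences, left and right
    sides, share one proof. *)
Definition ltz x y := if s then x < y else y < x.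
Definition lez x y := if s then x <= y else y <= x.

Lemma lezz x : lez x x. Proof. by rewrite /lez; case: s. Qed.

Lemma ltzz x : ltz x x = false. Proof. by rewrite /ltz; case: s; rewrite ltxx. Qed.

Lemma lezNgt x y : lez x y = ~~ ltz y x.
Proof. by rewrite /lez /ltz; case: s; rewrite leNgt. Qed.

Lemma ltzW x y : ltz x y -> lez x y.
Proof. by rewrite /lez /ltz; case: s; exact: ltW. Qed.

Lemma ltz_trans y x z : ltz x y -> ltz y z -> ltz x z.
Proof.
rewrite /ltz; case: s => [|yx zy]; first exact: lt_trans.
exact: lt_trans zy yx.
Qed.

Lemma lez_trans y x z : lez x y -> lez y z -> lez x z.
Proof.
rewrite /lez; case: s => [|yx zy]; first exact: le_trans.
exact: le_trans zy yx.
Qed.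

Lemma ltz_lez_trans y x z : ltz x y -> lez y z -> ltz x z.
Proof.
rewrite /ltz /lez; case: s => [|yx zy]; first exact: lt_le_trans.
exact: le_lt_trans zy yx.
Qed.

Lemma lez_ltz_trans y x z : lez x y -> ltz y z -> ltz x z.
Proof.
rewrite /ltz /lez; case: s => [|yx zy]; first exact: le_lt_trans.
exact: lt_le_trans zy yx.
Qed.

Lemma lez_eqVlt x y : lez x y -> x = y \/ ltz x y.
Proof.
rewrite /lez /ltz; case: s; rewrite le_eqVlt => /predU1P[|]; by [left|right].
Qed.

End SignedOrder.

(** * Compact LOTSes: extrema and monotone limits *)

Section CompactLOTS.
Context (d : Order.disp_t) (Z : orderTopologicalType d).
Implicit Types (x y z c : Z) (s : bool).

Lemma ltz_open_gt s x : open [set z | ltz s x z].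
Proof.
rewrite /ltz; case: s.
- by have := rray_open x; rewrite set_itvE.
- by have := lray_open x; rewrite set_itvE.
Qed.

Lemma ltz_open_lt s x : open [set z | ltz s z x].
Proof. by have := @ltz_open_gt (~~ s) x; rewrite /ltz; case: s. Qed.

Definition convex_set (U : set Z) := forall x y z, U x -> U y -> x <= z <= y -> U z.

Lemma convex_setz (U : set Z) s x y z : convex_set U -> U x -> U y ->
  lez s x z -> lez s z y -> U z.
Proof.
move=> cU Ux Uy; rewrite /lez; case: s => h1 h2.
- by apply: (cU x y) => //; rewrite h1.
- by apply: (cU y x) => //; rewrite h2.
Qed.

Lemma nbhs_convex c (N : set Z) : nbhs c N ->
  exists U : set Z, [/\ open U, U c, U `<=` N & convex_set U].
Proof.
rewrite itv_nbhsE => -[[l r] [oi ci] iN]; exists [set` Interval l r]; split=> //.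
  exact: itv_open_ends_open.
move=> x y z /=; rewrite !itv_boundlr => /andP[x1 x2] /andP[y1 y2] /andP[xz zy].
apply/andP; split.
- by apply: le_trans x1 _; rewrite bnd_simp.
- by apply: le_trans y2; rewrite bnd_simp.
Qed.

Hypothesis cZ : compact [set: Z].

(** The final segments of [A] in direction [s] generate a filter, and a cluster point of it is the
    extremum. *)
Lemma compact_extremum s (A : set Z) : closed A -> A !=set0 ->
  exists2 m, A m & forall a, A a -> lez s a m.
Proof.
move=> clA [a0 Aa0].
pose F := filter_from A (fun a => [set z | A z /\ lez s a z]).
have FF : ProperFilter F.
  apply: filter_from_proper; last first.
    by move=> a Aa; exists a; split=> //; exact: lezz.
  apply: filter_from_filter; first by exists a0.
  move=> a b Aa Ab; have [ab|] := boolP (lez s a b).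
    by exists b => // z [Az bz]; do 2!split=> //; exact: lez_trans bz.
  rewrite lezNgt negbK => /ltzW ba.
  by exists a => // z [Az az]; do 2!split=> //; exact: lez_trans az.
have [|c [_ clc]] := cZ FF; first by exists a0.
exists c.
  apply: clA => B nB; have [|z [[Az _] Bz]] := clc [set z | A z /\ lez s a0 z] B _ nB.
    by exists a0.
  by exists z.
move=> a Aa; rewrite lezNgt; apply/negP => ca.
have [||z [[_ az] /= za]] := clc [set z | A z /\ lez s a z] [set z | ltz s z a].
- by exists a.
- by apply: open_nbhs_nbhs; split; [exact: ltz_open_lt|].
by move: az; rewrite lezNgt za.
Qed.

(** The limit is the extremum of the closure of the range; a convex neighbourhood that contains one
    term contains all later ones. *)
Lemma monotone_limit s dW (W : orderType dW) (w0 : W) (g : W -> Z) :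
  (forall a b, a <= b -> lez s (g a) (g b)) ->
  exists2 c, (forall a, lez s (g a) c) &
    forall N, nbhs c N -> exists b, forall a, b <= a -> N (g a).
Proof.
move=> mg; have [||c clc cmax] := @compact_extremum s (closure (range g)).
- exact: closed_closure.
- by exists (g w0); apply: subset_closure; exists w0.
have gc a : lez s (g a) c by apply: cmax; apply: subset_closure; exists a.
exists c => // N /nbhs_convex[U [oU Uc UN cU]].
have [|_ [[b _ <-] Ub]] := clc U; first exact: open_nbhs_nbhs.
exists b => a ba; apply: UN; apply: (convex_setz (s := s) cU Ub Uc) => //.
exact: mg.
Qed.

Lemma limit_lez s (x : nat -> Z) c z : seq_cvg x c -> (forall k, lez s (x k) z) ->
  lez s c z.
Proof.
move=> cx xz; rewrite lezNgt; apply/negP => zc.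
have [|k /(_ k (leqnn k)) /= h] := cx [set y | ltz s z y].
  by apply: open_nbhs_nbhs; split; [exact: ltz_open_gt|].
by have := xz k; rewrite lezNgt h.
Qed.

Lemma monotone_sequence_limit s (x : nat -> Z) :
  (forall k, ltz s (x k) (x k.+1)) ->
  exists2 c, seq_cvg x c & forall k, ltz s (x k) c.
Proof.
move=> mx; have mx' a b : (a <= b)%N -> lez s (x a) (x b).
  elim: b => [|b IH]; first by rewrite leqn0 => /eqP->; exact: lezz.
  rewrite leq_eqVlt => /predU1P[->|]; first exact: lezz.
  by rewrite ltnS => /IH /lez_trans; apply; exact/ltzW.
have [c xc cx] := @monotone_limit s _ nat 0%N x mx'.
by exists c => // k; apply: ltz_lez_trans (mx k) (xc _).
Qed.

End CompactLOTS.

(** * Limits of omega_1-sequences in a compact LOTS *)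

(** An unbounded sequence would make [W] a countable union of countable initial segments. *)
Lemma omega1_countable_bounded dW (W : orderType dW) : is_omega1 W ->
  forall s : nat -> W, exists w, forall n, s n < w.
Proof.
move=> [_ nW cW] s; apply: contrapT => h; apply: nW.
have -> : [set: W] = \bigcup_n ([set a | a < s n] `|` [set s n]).
  apply/seteqP; split=> // w _; apply: contrapT => h'; apply: h; exists w => n.
  case: ltgtP => // [lt|eq]; case: h'; exists n => //; by [left|right].
apply: bigcup_countable; first exact: countableP.
move=> n _; rewrite -bigcup2E; apply: bigcup_countable; first exact: countableP.
case=> [|[|i]] _ /=; [exact: cW|exact: countable1|exact: countable0].
Qed.

Section OmegaSpace.
Context (d : Order.disp_t) (Z : orderTopologicalType d) (cZ : compact [set: Z]).
Context (dW : Order.disp_t) (W : orderType dW) (oW : is_omega1 W).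
Context (s : bool) (g : W -> Z) (mg : forall a b, a < b -> ltz s (g a) (g b)).

(** The limit [o] of the whole sequence serves. A convex open [U] around it contains a tail of the
    sequence, hence also the limits of the increasing countable sequences in that tail, and is taken
    as [Y]. *)
Lemma omega1_point : exists o : Z, forall N, nbhs o N ->
  exists (Y : topologicalType) (xi : Y -> Z),
  [/\ omega1_space Y, continuous xi, injective xi & forall y, N (xi y)].
Proof.
have bW := omega1_countable_bounded oW.
have [w1 _] : exists w : W, True.
  apply: contrapT => h; case: oW => _ + _; apply.
  have -> : [set: W] = set0; last exact: countable0.
  by apply/seteqP; split=> // w _; case: h; exists w.
have mg' a b : a <= b -> lez s (g a) (g b).
  by rewrite le_eqVlt => /predU1P[->|/mg /ltzW //]; exact: lezz.
have [o go co] := monotone_limit cZ w1 mg'.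
exists o => N /nbhs_convex[U [oU Uo UN cU]].
have [w0 hw0] : exists b, forall a, b <= a -> U (g a).
  by apply: co; exact: open_nbhs_nbhs.
have /choice[lZ hlZ] : forall al : nat -> W, exists c : Z,
    (forall n, al n < al n.+1) ->
    seq_cvg (g \o al) c /\ forall k, ltz s (g (al k)) c.
  move=> al; have [mal|?] := pselect (forall n, al n < al n.+1); last by exists o.
  have [k|c cc lc] := monotone_sequence_limit cZ (s := s) (x := g \o al).
    exact: mg.
  by exists c.
have lo al : (forall n, al n < al n.+1) -> lez s (lZ al) o.
  by move=> /hlZ[c1 _]; apply: (limit_lez c1) => k; exact: go.
have lU al : (forall n, al n < al n.+1) -> w0 <= al 0%N -> U (lZ al).
  move=> mal w0a; have [_ h] := hlZ _ mal.
  exact: (convex_setz cU (hw0 _ w0a) Uo (ltzW (h 0%N)) (lo _ mal)).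
exists (set_type U), set_val; split=> //; last by move=> y; apply: UN; exact: set_valP.
(* Points outside [U] get the default value [o]; the index [w0] keeps them out of play. *)
- pose toU z : set_type U := if pselect (U z) is left Uz then to_set Uz else to_set Uo.
  have toUE z : U z -> set_val (toU z) = z.
    by move=> Uz; rewrite /toU; case: pselect.
  exists dW, W, (toU \o g), (toU o), (toU \o lZ), w0; split=> //.
  + move=> P /nbhs_set_type[V [oV]]; rewrite toUE// => Vo VP.
    have [|b hb] := co V; first exact: open_nbhs_nbhs.
    exists (Order.max b w0) => a; rewrite ge_max => /andP[ba w0a]; apply: VP => /=.
    by rewrite toUE; [exact: hb|exact: hw0].
  + move=> al mal w0a P /nbhs_set_type[V [oV]]; rewrite toUE; last exact: lU.
    move=> Vl VP; have /nbhs_convex[V' [oV' V'l V'V cV']] := open_nbhs_nbhs (conj oV Vl).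
    have [n0 hn0] := (hlZ _ mal).1 V' (open_nbhs_nbhs (conj oV' V'l)).
    exists n0 => c n0c [n cn]; apply: VP => /=; rewrite toUE; last first.
      by apply: hw0; apply: le_trans w0a (le_trans (incr_le mal (leq0n _)) n0c).
    apply: V'V; apply: (convex_setz (s := s) cV' (hn0 n0 (leqnn _)) V'l).
      exact: mg'.
    by apply: lez_trans (mg' _ _ (ltW cn)) _; apply: ltzW; exact: (hlZ _ mal).2.
  + move=> al mal w0a P /nbhs_set_type[V [oV]]; rewrite toUE; last exact: lU.
    move=> Vl VP; have /nbhs_convex[V' [oV' V'l V'V cV']] := open_nbhs_nbhs (conj oV Vl).
    have [n0 hn0] := (hlZ _ mal).1 V' (open_nbhs_nbhs (conj oV' V'l)).
    exists n0 => be mbe n0b [n bn]; apply: VP => /=; rewrite toUE; last first.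
      apply: lU => //; apply: le_trans w0a (le_trans (incr_le mal (leq0n _)) n0b).
    apply: V'V; apply: (convex_setz (s := s) cV' (hn0 n0 (leqnn _)) V'l).
      by apply: lez_trans (mg' _ _ n0b) _; apply: ltzW; exact: (hlZ _ mbe).2.
    apply: (@lez_trans _ _ _ (g (al n))).
      by apply: (limit_lez (hlZ _ mbe).1) => k; exact/mg'/ltW.
    by apply: ltzW; exact: (hlZ _ mal).2.
  + move=> al be mal w0a mbe w0b [n bn] /= /(congr1 set_val).
    rewrite !toUE; [|exact: lU|exact: lU] => eql.
    have : ltz s (lZ be) (lZ al).
      apply: (@lez_ltz_trans _ _ _ (g (al n))); last exact: (hlZ _ mal).2.
      by apply: (limit_lez (hlZ _ mbe).1) => k; exact/mg'/ltW.
    by rewrite eql ltzz.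
- exact: set_val_continuous.
Qed.

End OmegaSpace.

(** * Convergent sequences in an infinite compact LOTS *)

(** Either from some index on every term has a larger later one, and an increasing sequence results,
    or there are arbitrarily late terms without a larger later one, and these decrease. *)
Lemma infinite_monotone (d : Order.disp_t) (T : orderType d) :
  infinite_set [set: T] ->
  exists s (x : nat -> T), forall k, ltz s (x k) (x k.+1).
Proof.
move=> /infiniteP/card_leP[u0].
pose u (n : nat) : T := set_val (u0 (exist _ n (mem_set I))).
have iu n m : u n = u m -> n = m.
  by move=> /val_inj /('inj_u0) h; have /(congr1 set_val) := h (mem_set I) (mem_set I).
have [[N hN]|nN] := pselect (exists N : nat, forall n, (N <= n)%N ->
    exists2 m, (n < m)%N & u n < u m).
  have /choice[nx hnx] : forall n, exists m, (N <= n)%N -> (n < m)%N /\ u n < u m.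
    move=> n; have [/hN[m ? ?]|?] := boolP (N <= n)%N; first by exists m.
    by exists 0%N.
  have Nk k : (N <= iter k nx N)%N.
    by elim: k => //= k IH; apply: leq_trans IH (ltnW (hnx _ IH).1).
  by exists true, (fun k => u (iter k nx N)) => k; exact: (hnx _ (Nk k)).2.
have /choice[pk hpk] : forall N, exists n, (N <= n)%N /\
    forall m, (n < m)%N -> ~ (u n < u m).
  move=> N; apply: contrapT => h; apply: nN; exists N => n Nn.
  apply: contrapT => h'; apply: h; exists n; split=> // m nm um; apply: h'.
  by exists m.
exists false, (fun k => u (iter k (fun n => pk n.+1) (pk 0%N))) => k /=.
set n := iter _ _ _.
have [j nj] : exists j, n = pk j.
  by rewrite /n; case: (k) => [|k'] /=; [exists 0%N|eexists].
have n1 : (n < pk n.+1)%N by exact: (hpk n.+1).1.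
rewrite /ltz lt_neqAle; apply/andP; split.
  by apply/eqP => /iu eqn; move: n1; rewrite eqn ltnn.
by rewrite leNgt; apply/negP; rewrite {1}nj; apply: (hpk j).2; rewrite -nj.
Qed.

(** Serves the factor with second countable closure: a tail of a monotone sequence, together with
    its limit, contributes one to the count. *)
Lemma convergent_point (d : Order.disp_t) (Z : orderTopologicalType d) :
  compact [set: Z] -> infinite_set [set: Z] ->
  exists o : Z, forall N, nbhs o N -> exists (Y : topologicalType) (xi : Y -> Z),
  [/\ omega1_core Y 1%N, continuous xi, injective xi & forall y, N (xi y)].
Proof.
move=> cZ /infinite_monotone[s [x mx]].
have [o co xo] := monotone_sequence_limit cZ mx.
exists o => N nN; have [k0 hk0] := co _ nN.
have no k : x (k0 + k)%N <> o.
  by move=> e; have := xo (k0 + k)%N; rewrite e ltzz.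
have [C [eC [io [c [c0 [sC cio iio [cc nc] [ic0 ic hC]]]]]]] :=
  convergent_sequence_space (seq_cvg_shift k0 co) no.
exists C, io; split=> //; first exact: omega1_core_sequence cc nc.
move=> y; case: (hC y) => [->|[k ->]].
- by rewrite ic0; exact: nbhs_singleton.
- by rewrite ic; apply: hk0; exact: leq_addr.
Qed.

(** In a finite LOTS points are open, so a perfect set would have isolated points. *)
Lemma nonscattered_infinite (d : Order.disp_t) (Z : orderTopologicalType d) (F : set Z) :
  ~ scattered (set_type F) -> infinite_set [set: Z].
Proof.
move=> nsc fZ; apply: nsc => P [_ [x Px]] /seteqP[isoP _]; apply: (isoP x).
split; first by rewrite inE.
exists [set y | set_val y = set_val x]; last first.
  by apply/seteqP; split=> [y [/= /val_inj]|y ->].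
apply: open_nbhs_nbhs; split=> //.
exists [set set_val x] => //.
rewrite -[X in open X]setCK; apply: closed_openC.
have /accessible_finite_set_closed := hausdorff_accessible (@order_hausdorff _ Z).
by apply; apply: sub_finite_set fZ.
Qed.

(** * Countable sets *)

Lemma countable_sub (T : Type) (A B : set T) : A `<=` B -> countable B -> countable A.
Proof. by move=> AB; apply: sub_countable; exact: subset_card_le. Qed.

Lemma countable_union (T : Type) (A B : set T) :
  countable A -> countable B -> countable (A `|` B).
Proof.
move=> cA cB; rewrite -bigcup2E; apply: bigcup_countable; first exact: countableP.
by case=> [|[|i]] _ /=; [| |exact: countable0].
Qed.

Lemma countable_im (T U : Type) (f : T -> U) (A : set T) :
  countable A -> countable (f @` A).
Proof. by apply: sub_countable; exact: card_image_le. Qed.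

Lemma countable_enum (T : Type) (A : set T) : countable A -> A !=set0 ->
  exists2 e : nat -> T, (forall n, A (e n)) & forall a, A a -> exists n, e n = a.
Proof.
move=> /countable_injP[f injf] [a0 Aa0].
have /choice[e he] : forall n, exists a, A a /\
    ((exists2 b, A b & f b = n) -> f a = n).
  move=> n; have [[b Ab fb]|nb] := pselect (exists2 b, A b & f b = n).
    by exists b.
  by exists a0.
exists e => [n|a Aa]; first exact: (he n).1.
exists (f a); apply: injf; rewrite ?inE//; first exact: (he _).1.
by apply: (he _).2; exists a.
Qed.

(** * Jumps in the closure of a countable set *)

Section JumpSpace.
Context (d : Order.disp_t) (Z : orderTopologicalType d) (cZ : compact [set: Z]).
Context (D : set Z) (cD : countable D).
Notation F := (closure D).

(** Neighbours within [F]; points of [Z] outside [F] may lie between them. *)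
Definition jump u v := [/\ F u, F v, u < v & forall z, F z -> u < z -> v <= z].

Definition jumpz s u v := if s then jump u v else jump v u.

Lemma jumpzP s u v : F u -> F v -> ltz s u v -> (forall z, F z -> ltz s u z -> ltz s z v -> False) ->
  jumpz s u v.
Proof.
rewrite /jumpz /ltz; case: s => Fu Fv uv h; split=> // z Fz.
- by move=> uz; rewrite leNgt; apply/negP => zv; exact: h uz zv.
- by move=> vz; rewrite leNgt; apply/negP => zu; exact: h zu vz.
Qed.

Definition jump_ends := [set u | exists v, jump u v \/ jump v u].

(* [None] stands for an infinite end. *)
Lemma one_sided_base s x (U : set Z) : F x -> open U -> U x ->
  exists l : option Z, (if l is Some a then (D `|` jump_ends) a /\ ltz s a x else True) /\
    forall z, F z -> (if l is Some a then ltz s a z else true) -> lez s z x -> U z.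
Proof.
move=> Fx oU Ux; have [V [oV Vx VU cV]] := nbhs_convex (open_nbhs_nbhs (conj oU Ux)).
have jend a : jumpz s a x -> jump_ends a.
  by rewrite /jumpz; case: s => ?; exists x; [left|right].
(* If [V] contains a point of [F] before [x], the end is a point of [D] in between or, failing that,
   the neighbour of [x] in [F]. *)
have [[z0 [Fz0 z0x Vz0]]|nz0] := pselect (exists z, [/\ F z, ltz s z x & V z]).
  have [[z1 [Fz1 z01 z1x]]|nz1] := pselect (exists z, [/\ F z, ltz s z0 z & ltz s z x]).
    have [|a [Da [/= z0a ax]]] := Fz1 ([set z | ltz s z0 z] `&` [set z | ltz s z x]).
      apply: open_nbhs_nbhs; split=> //; apply: openI.
      + exact: ltz_open_gt.
      + exact: ltz_open_lt.
    exists (Some a); split; first by split=> //; left.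
    move=> z Fz az zx; apply: VU; apply: (convex_setz (s := s) cV Vz0 Vx) => //.
    exact/ltzW/(ltz_trans z0a).
  have jx : jumpz s z0 x.
    by apply: jumpzP => // z Fz ? ?; apply: nz1; exists z.
  exists (Some z0); split; first by split=> //; right; exact: jend jx.
  move=> z Fz z0z zx; have [->//|zx'] := lez_eqVlt zx.
  by case: nz1; exists z.
have [[z0 [Fz0 z0x]]|nz1] := pselect (exists z, F z /\ ltz s z x); last first.
  exists None; split=> // z Fz _ zx; have [->//|zx'] := lez_eqVlt zx.
  by case: nz1; exists z.
(* Now [V] misses all points of [F] before [x], so these form the closed set [G], and its extremum
   is the neighbour of [x]. *)
pose G := F `&` ~` [set z | ltz s x z] `&` ~` V.
have [||m [[Fm mx] nVm] mmax] := @compact_extremum _ _ cZ s G.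
- apply: closedI; first apply: closedI.
  + exact: closed_closure.
  + by apply: open_closedC; exact: ltz_open_gt.
  + exact: open_closedC.
- exists z0; split; [split|] => //=.
  + by move=> /(ltz_trans z0x); rewrite ltzz.
  + by move=> Vz0; apply: nz0; exists z0.
have {}mx : ltz s m x.
  have [e|//] : m = x \/ ltz s m x by apply: lez_eqVlt; rewrite lezNgt; exact/negP.
  by case: nVm; rewrite e.
have Gz z : F z -> ltz s z x -> lez s z m.
  move=> Fz zx; apply: mmax; split; [split|] => //=.
  + by move=> /(ltz_trans zx); rewrite ltzz.
  + by move=> Vz; apply: nz0; exists z.
have jx : jumpz s m x.
  apply: jumpzP => // z Fz mz zx.
  by have := Gz _ Fz zx; rewrite lezNgt mz.
exists (Some m); split; first by split=> //; right; exact: jend jx.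
move=> z Fz mz zx; have [->//|zx'] := lez_eqVlt zx.
by have := Gz _ Fz zx'; rewrite lezNgt mz.
Qed.

Definition left_ends := [set u | exists v, jump u v].

Lemma jump_unique u v v' : jump u v -> jump u v' -> v = v'.
Proof.
move=> [_ Fv uv h] [_ Fv' uv' h']; apply/eqP; rewrite eq_le; apply/andP; split.
- exact: h.
- exact: h'.
Qed.

(** By [one_sided_base] on both sides, the intervals whose ends are infinite, in [D] or ends of
    jumps form a base of [F]. A jump is determined by its left end, so all these ends are countably
    many. *)
Lemma countable_jumps_second_countable : countable left_ends ->
  @second_countable (set_type F).
Proof.
move=> cL.
have cE : countable (D `|` jump_ends).
  apply: countable_union => //.
  have /choice[r hr] : forall u, exists v, left_ends u -> jump u v.
    move=> u; have [[v uv]|?] := pselect (left_ends u); first by exists v.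
    by exists u.
  apply: (@countable_sub _ _ (left_ends `|` r @` left_ends)).
    move=> u [v [uv|vu]]; first by left; exists v.
    right; exists v; first by exists u.
    by apply: (jump_unique (hr v _) vu); exists u.
  by apply: countable_union => //; exact: countable_im.
pose E := [set None] `|` Some @` (D `|` jump_ends).
have cE' : countable E.
  by apply: countable_union; [exact: countable1|exact: countable_im].
pose I (lr : option Z * option Z) := [set z : set_type F |
  (if lr.1 is Some a then a < set_val z else true) /\
  (if lr.2 is Some b then set_val z < b else true)].
have oI lr : open (I lr).
  have orr (l : option Z) : open [set z | if l is Some a then a < z else true].
    case: l => [a|]; [exact: (ltz_open_gt true)|exact: open_cst].
  have oll (l : option Z) : open [set z | if l is Some a then z < a else true].
    case: l => [a|]; [exact: (ltz_open_lt true)|exact: open_cst].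
  by eexists; [exact: (openI (orr lr.1) (oll lr.2))|].
exists (I @` (E `*` E)); first by apply: countable_im; exact: countableX.
split; first by move=> _ [lr _ <-].
move=> x N /nbhs_set_type[U [oU Ux UN]].
have [l [hl1 hl2]] := one_sided_base true (set_valP x) oU Ux.
have [r [hr1 hr2]] := one_sided_base false (set_valP x) oU Ux.
exists (I (l, r)).
  split.
    exists (l, r) => //; split=> /=.
    - by case: l hl1 {hl2} => [a [Ea _]|_]; [right; exists a|left].
    - by case: r hr1 {hr2} => [a [Ea _]|_]; [right; exists a|left].
  by split=> /=; [case: l hl1 {hl2} => // a []|case: r hr1 {hr2} => // a []].
move=> z [/= h1 h2]; apply: UN => /=.
have [zx|xz] := leP (set_val z) (set_val x).
- by apply: (hl2 (set_val z)) zx; [exact: set_valP|case: (l) h1].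
- by apply: (hr2 (set_val z)) (ltW xz); [exact: set_valP|case: (r) h2].
Qed.

(** Around a point where left ends accumulate uncountably, take [Y] to be [F] within a convex open
    [U], and keep the jumps inside [U] whose left end is not in [D]. Such a left end is a limit of
    [D] from the left, so the traces of []a, u]] with [a] in [D] are a base at it. *)
Lemma jump_point : ~ @second_countable (set_type F) ->
  exists o : Z, forall N, nbhs o N -> exists (Y : topologicalType) (xi : Y -> Z),
  [/\ jump_space Y, continuous xi, injective xi & forall y, N (xi y)].
Proof.
move=> nsc; have nL : ~ countable left_ends.
  by move=> cL; apply: nsc; exact: countable_jumps_second_countable.
have [o ho] : exists o : Z, forall N, nbhs o N -> ~ countable (left_ends `&` N).
  (* A cluster point of the filter of sets that contain all but countably many left ends. *)
  pose G : set_system Z := [set A | countable (left_ends `\` A)].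
  have GG : ProperFilter G.
    split.
      by rewrite /G /= => h; apply: nL; move: h; rewrite setD0.
    split.
    - by rewrite /G /= setDT; exact: countable0.
    - by move=> A B cA cB; rewrite /G /= setDIr; exact: countable_union.
    - move=> A B AB; apply: countable_sub => z [Lz nBz]; split=> // Az.
      by apply: nBz; exact: AB.
  have [|o [_ clo]] := cZ GG; first by rewrite /G /= setDT; exact: countable0.
  exists o => N nN cN.
  have [|z [[_ nNz] Nz]] := clo (left_ends `\` N) N _ nN => //.
  rewrite /G /=; apply: countable_sub cN => z [Lz h]; split=> //.
  by apply: contrapT => nNz; apply: h.
exists o => N /nbhs_convex[U [oU Uo UN cU]].
have nU : ~ countable (left_ends `&` U) by apply: ho; exact: open_nbhs_nbhs.
pose P := [set u | [/\ left_ends u, U u, ~ D u & exists2 v, jump u v & U v]].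
have nP : ~ countable P.
  move=> cP; apply: nU.
  (* Discarding is harmless: [D] is countable, and by convexity at most one jump leads out of
     [U]. *)
  pose Q := [set u | [/\ left_ends u, U u & forall v, jump u v -> ~ U v]].
  apply: (@countable_sub _ _ (P `|` D `|` Q)).
    move=> u [Lu Uu]; have [Du|Du] := pselect (D u); first by left; right.
    have [v uv] := Lu; have [Uv|Uv] := pselect (U v).
      by left; left; split=> //; exists v.
    by right; split=> // v' /(jump_unique uv) <-.
  apply: countable_union; first exact: countable_union.
  have Qlt u u' : Q u -> Q u' -> ~ (u < u').
    move=> [[v uv] Uu hQ] [[v' [Fu' _ _ _]] Uu' _] uu'; apply: (hQ v) => //.
    case: uv => Fu Fv ultv hv; apply: (cU u u') => //.
    by rewrite (ltW ultv) /=; exact: hv.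
  apply/countable_injP; exists (fun=> 0%N) => u u'; rewrite !inE => Qu Qu' _.
  by apply/eqP; case: ltgtP => // h; case: (Qlt _ _ _ _ h).
(* The ray below [v] is a neighbourhood of [u] with no point of [F] beyond [u], so points of [D] in
   it lie to the left of [u]. *)
have P_limit u (V : set Z) : P u -> open V -> V u -> exists2 z, F z & z < u /\ V z.
  move=> [_ _ nDu [v [Fu Fv uv huv] _]] oV Vu.
  have [|z [Dz [Vz zv]]] := Fu (V `&` [set z | z < v]).
    apply: open_nbhs_nbhs; split=> //; apply: openI => //.
    exact: (ltz_open_lt true).
  exists z; first exact: subset_closure.
  split=> //; case: (ltgtP z u) => // [uz|e]; last by case: nDu; rewrite -e.
  by have := huv z (subset_closure Dz) uz; rewrite leNgt zv.
have /choice[hi hhi] : forall u, exists v, P u -> jump u v /\ U v.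
  move=> u; have [[_ _ _ [v ? ?]]|?] := pselect (P u); first by exists v.
  by exists u.
have [e0 he0 e0D] : exists2 e : nat -> Z, (forall n, (D `&` U) (e n)) &
    forall a, (D `&` U) a -> exists n, e n = a.
  apply: countable_enum; first by apply: countable_sub cD => z [].
  apply: contrapT => h; apply: nU; suff -> : left_ends `&` U = set0 by exact: countable0.
  apply/seteqP; split=> // u [[v [Fu _ _ _]] Uu]; apply: h.
  have [|z [Dz Uz]] := Fu U; first exact: open_nbhs_nbhs.
  by exists z.
pose Y := set_type (F `&` U).
have FUe n : (F `&` U) (e0 n) by have [? ?] := he0 n; split=> //; exact: subset_closure.
have FUlo (u : set_type P) : (F `&` U) (set_val u).
  by have [[v []] ? ? ?] := set_valP u.
have FUhi (u : set_type P) : (F `&` U) (hi (set_val u)).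
  by have [[? ? _ _] ?] := hhi _ (set_valP u).
exists Y, set_val; split=> //; last first.
- by move=> y; apply: UN; have [] := set_valP y.
- exact: set_val_continuous.
exists (fun n => to_set (FUe n)), (set_type P), (fun u => to_set (FUlo u)),
  (fun u => to_set (FUhi u)), (fun c u => [set z | e0 c < set_val z <= set_val u]).
split.
- move=> _ [V oV <-] [y Vy]; have [Fy Uy] := set_valP y.
  have [|z [Dz [Vz Uz]]] := Fy (V `&` U).
    by apply: open_nbhs_nbhs; split=> //; exact: openI.
  by have [n nz] := e0D z (conj Dz Uz); exists n; rewrite /= to_setK nz.
- by rewrite (eq_countable (card_setT P)).
- move=> u /(congr1 set_val); rewrite !to_setK => e.
  by have [[_ _ + _] _] := hhi _ (set_valP u); rewrite -e ltxx.
- move=> u M /nbhs_set_type[V [oV /= Vu VM]]; rewrite to_setK in Vu.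
  have [_ Uu] := FUlo u.
  have /nbhs_convex[V' [oV' V'u V'V cV']] := open_nbhs_nbhs (conj (openI oV oU) (conj Vu Uu)).
  have [z0 Fz0 [z0u V'z0]] := P_limit _ _ (set_valP u) oV' V'u.
  have [||z1 Fz1 [z1u [/= z01 V'z1]]] := P_limit _ ([set z | z0 < z] `&` V') (set_valP u).
  + by apply: openI => //; exact: (ltz_open_gt true).
  + by split.
  have [|a [Da [[z0a au] V'a]]] := Fz1 ([set z | z0 < z] `&` [set z | z < set_val u] `&` V').
    apply: open_nbhs_nbhs; split=> //; apply: openI => //; apply: openI.
    + exact: (ltz_open_gt true).
    + exact: (ltz_open_lt true).
  have [|c ca] := e0D a; first by split=> //; exact: (V'V _ V'a).2.
  exists c; first by rewrite /= ca au /=.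
  move=> z /= /andP[cz zu]; apply: VM => /=; apply: (V'V _ _).1.
  apply: (cV' z0 (set_val u)) => //; rewrite zu andbT.
  by apply/ltW/(lt_trans z0a); rewrite -ca.
- have main (c : nat) (y y' : set_type P) : e0 c < set_val y -> set_val y < set_val y' ->
      (e0 c < set_val y <= set_val y') /\ (e0 c < hi (set_val y) <= set_val y').
    move=> cy yy'; have [[_ _ ylt h] _] := hhi _ (set_valP y).
    split; first by rewrite cy ltW.
    by rewrite (lt_trans cy ylt) /=; apply: h => //; have [] := FUlo y'.
  move=> c y y' /= /andP[cy _] /andP[cy' _] ne.
  have : (set_val y < set_val y') || (set_val y' < set_val y).
    by rewrite -neq_lt; apply/eqP => /val_inj.
  move=> /orP[lt|gt]; [left|right].
  + exact: (main c y y' cy lt).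
  + exact: (main c y' y cy' gt).
Qed.

End JumpSpace.

(** * The product topology *)

Lemma eval_continuous (I : Type) (T : I -> topologicalType) (i : I) :
  continuous (fun x : prod_topology T => x i).
Proof.
move=> x U; rewrite nbhsE => -[C [oC Cx] CU].
have /cvg_sup/(_ i) h : nbhs x --> x by exact: cvg_id.
apply: (@filterS _ (nbhs x) _ [set y | C (y i)]); first by move=> y /CU.
apply: h; pose X := initial_topology (fun f : (forall i, T i) => f i).
by apply: (@open_nbhs_nbhs X); split=> //; exists C.
Qed.

Lemma prod_cvg (I : Type) (T : I -> topologicalType) (F : set_system (prod_topology T))
    (x : prod_topology T) : Filter F ->
  (forall i (U : set (T i)), open U -> U (x i) -> F [set y | U (y i)]) -> F --> x.
Proof.
move=> FF h; apply/cvg_sup => i U.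
have /= -> := @nbhsE (initial_topology (fun f : (forall i, T i) => f i)) x.
case=> B [[C oC <- Cx]] /filterS; apply.
exact: (h i).
Qed.

Lemma prod_continuous (X : topologicalType) (I : Type) (T : I -> topologicalType)
    (f : X -> prod_topology T) : (forall i, continuous (fun x => f x i)) -> continuous f.
Proof.
move=> cf x; apply: prod_cvg => i U oU Ux.
by apply: (cf i x); exact: open_nbhs_nbhs.
Qed.

(** The sets containing a box around [x] form a filter, which converges to [x] because each
    coordinate can be constrained alone. *)
Lemma nbhs_prod_box (I : eqType) (T : I -> topologicalType) (x : prod_topology T)
    (U : set (prod_topology T)) : nbhs x U ->
  exists N : forall i, set (T i), (forall i, nbhs (x i) (N i)) /\
    forall y, (forall i, N i (y i)) -> U y.
Proof.
pose F : set_system (prod_topology T) := [set A | exists N : forall i, set (T i),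
  (forall i, nbhs (x i) (N i)) /\ forall y, (forall i, N i (y i)) -> A y].
have FF : Filter F.
  split.
  - by exists (fun=> setT); split=> // i; exact: filterT.
  - move=> A B [N [h1 h2]] [M [h1' h2']]; exists (fun i => N i `&` M i); split.
      by move=> i; exact: filterI.
    by move=> y h; split; [apply: h2|apply: h2'] => i; have [] := h i.
  - by move=> A B AB [N [h1 h2]]; exists N; split=> // y /h2 /AB.
suff : F --> x by apply.
apply: prod_cvg => i V oV Vx; exists (dfwith (fun j => [set: T j]) i V); split.
  by move=> j; case: dfwithP => [|k _]; [exact: open_nbhs_nbhs|exact: filterT].
by move=> y /(_ i); rewrite dfwithin.
Qed.

(** * Placing cores in the coordinates of the product *)

Section Realization.
Context (I : eqType) (T : I -> topologicalType) (x0 : prod_topology T).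
Context (N : forall i, set (T i)).

(** A continuous injection is enough, because the final contradiction is a failure of
    injectivity. *)
Definition realizes (l : seq I) (S : topologicalType) (psi : S -> prod_topology T) : Prop :=
  [/\ continuous psi, injective psi, forall s i, i \in l -> N (psi s i) &
      forall s i, i \notin l -> psi s i = x0 i].

Lemma realizes_point : realizes [::] (fun _ : point_space => x0).
Proof.
split=> //; first exact: cst_continuous.
by move=> [] [].
Qed.

Lemma realizes_cons (l : seq I) (S Y : topologicalType) (psi : S -> prod_topology T)
    i (xi : Y -> T i) : realizes l psi -> i \notin l ->
  continuous xi -> injective xi -> (forall y, N (xi y)) ->
  realizes (i :: l) (fun x : S * Y => dfwith (psi x.1) i (xi x.2)).
Proof.
move=> [cpsi ipsi Npsi opsi] il cxi ixi Nxi; split.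
- apply: prod_continuous => j.
  have [e|ij] := eqVneq i j; last first.
    rewrite (_ : (fun _ => _) = fun x => psi x.1 j); last first.
      by apply/funext => x; rewrite dfwithout.
    apply: (continuous_compose (f := fun s => psi s j)); last exact: continuous_fst.
    exact: (continuous_compose (@eval_continuous _ _ j) cpsi).
  case: j / e; rewrite (_ : (fun _ => _) = fun x => xi x.2); last first.
    by apply/funext => x; rewrite dfwithin.
  exact: (continuous_compose cxi (@continuous_snd _ _)).
- move=> [s y] [s' y'] /= e; congr pair.
    apply: ipsi; apply: functional_extensionality_dep => j.
    have [<-|ij] := eqVneq i j; first by rewrite !opsi.
    have := congr1 (fun f : prod_topology T => f j) e.
    by rewrite !dfwithout.
  have := congr1 (fun f : prod_topology T => f i) e.
  by rewrite !dfwithin => /ixi.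
- move=> [s y] j /=; case: dfwithP => [//|k ik]; rewrite inE eq_sym (negbTE ik) /=.
  exact: Npsi.
- move=> [s y] j /=; rewrite inE negb_or => /andP[ji jl].
  by rewrite dfwithout 1?eq_sym//; exact: opsi.
Qed.

Lemma realizes_one (Y : topologicalType) i (xi : Y -> T i) :
  continuous xi -> injective xi -> (forall y, N (xi y)) ->
  realizes [:: i] (fun y => dfwith x0 i (xi y)).
Proof.
move=> cxi ixi Nxi.
have [ch ih h1 h2] := realizes_cons realizes_point (isT : i \notin [::]) cxi ixi Nxi.
split=> [|y y' e|y|y].
- apply: (continuous_compose ch (h := fun y => (tt : point_space, y))).
  by apply: continuous_pair; [exact: cst_continuous|move=> y; exact: cvg_id].
- by case: (ih (tt, y) (tt, y') e).
- exact: (h1 (tt, y)).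
- exact: (h2 (tt, y)).
Qed.

(** Stated for abstract [Kind] and [Core], since it runs both inductions, over the
    omega_1-coordinates and over the jump coordinates. *)
Lemma realizes_iter (Kind : topologicalType -> Prop) (Core : topologicalType -> nat -> Prop) :
  (forall S Y n, Core S n -> Kind Y -> Core (S * Y)%type n.+1) ->
  forall l l0, uniq (l ++ l0) ->
  (forall i, i \in l -> exists (Y : topologicalType) (xi : Y -> T i),
    [/\ Kind Y, continuous xi, injective xi & forall y, N (xi y)]) ->
  forall (S0 : topologicalType) n0 (psi0 : S0 -> prod_topology T),
  Core S0 n0 -> realizes l0 psi0 ->
  exists (S : topologicalType) (psi : S -> prod_topology T),
  Core S (size l + n0)%N /\ realizes (l ++ l0) psi.
Proof.
move=> step l l0 + + S0 n0 psi0 core0 real0; elim: l => [_ _|i l IH].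
  by exists S0, psi0.
move=> /= /andP[il ul] hl.
have [|S [psi [core real]]] := IH ul.
  by move=> j jl; apply: hl; rewrite inE jl orbT.
have [Y [xi [KY cxi ixi Nxi]]] := hl i (mem_head _ _).
exists (S * Y)%type, (fun x => dfwith (psi x.1) i (xi x.2)); split.
- exact: step.
- exact: realizes_cons.
Qed.

Lemma realizes_pair (l l' : seq I) (S A : topologicalType) (psi : S -> prod_topology T)
    (phi : A -> prod_topology T) : {in l, forall i, i \notin l'} ->
  realizes l psi -> realizes l' phi ->
  realizes (l ++ l') (fun x : S * A => fun i => if i \in l then psi x.1 i else phi x.2 i).
Proof.
move=> dis [cpsi ipsi Npsi opsi] [cphi iphi Nphi ophi]; split.
- apply: prod_continuous => j; case: (j \in l).
    apply: (continuous_compose (f := fun s => psi s j)); last exact: continuous_fst.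
    exact: (continuous_compose (@eval_continuous _ _ j) cpsi).
  apply: (continuous_compose (f := fun s => phi s j)); last exact: continuous_snd.
  exact: (continuous_compose (@eval_continuous _ _ j) cphi).
- move=> [s y] [s' y'] /= e.
  have {}e j := congr1 (fun f : prod_topology T => f j) e.
  congr pair; [apply: ipsi|apply: iphi]; apply: functional_extensionality_dep => j.
  + by have := e j; case: (boolP (j \in l)) => // jl _; rewrite !opsi.
  + by have := e j; case: (boolP (j \in l)) => // jl _; rewrite !ophi// dis.
- move=> [s y] j; rewrite mem_cat /=; case: ifP => [jl _|_ /= jl']; first exact: Npsi.
  exact: Nphi.
- move=> [s y] j; rewrite mem_cat negb_or => /andP[jl jl'] /=.
  by rewrite (negbTE jl); exact: ophi.
Qed.

End Realization.

(** * Failure of injectivity and the lower bound *)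

(** First [A] is cut down to a countable [B]; then the jump core finds the point [s], starting with
    no recorded pairs ([void]) and with all [k] maps in [K]. *)
Lemma core_not_injective (S A : topologicalType) (n n' k : nat) (d : Order.disp_t)
    (L : 'I_k -> orderType d) (f : forall i, S * A -> L i) :
  jump_core S n -> omega1_core A n' -> (forall i, rcont (f i)) -> (k < n' + n)%N ->
  exists x y, x <> y /\ forall i, f i x = f i y.
Proof.
move=> [[e de] cS] cA cf kn.
have [B [eB [io [b0 [sB cio iio st]]]]] := cA d S e de k L f cf.
pose h i (x : S * B) := f i (x.1, io x.2).
have ch i : rcont (h i).
  apply: (rcont_comp (cf i)); apply: continuous_pair; first exact: continuous_fst.
  by apply: continuous_compose => //; exact: continuous_snd.
pose M (v : void) : orderType d := match v with end.
pose p (v : void) : S * B -> M v := match v with end.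
have [|||s hs] := cS d B eB b0 sB k n' L h ch st void M p p; try by case.
have [|[s' b] [nx hx _]] := hs [set: 'I_k]%SET; first by rewrite cardsT card_ord.
exists (s', io b), (s, io b0); split.
  by move=> [es /iio eb]; apply: nx; rewrite es eb.
by move=> i; apply: (hx i); rewrite inE.
Qed.

Lemma small_type_enum (T : Type) (n : nat) : ~ ([set: 'I_n] #<= [set: T])%card ->
  exists2 k, (k < n)%N & exists h : 'I_k -> T, forall x, exists i, h i = x.
Proof.
move=> nle; have fT : finite_set [set: T].
  apply: contrapT => /infiniteP nT; apply: nle; apply: card_le_trans nT.
  exact: countableP.
have [k Tk] := (finite_setP _).1 fT; exists k.
  rewrite ltnNge; apply/negP => nk; apply: nle.
  rewrite (card_le_eqr Tk); apply: (@card_le_trans _ _ _ `I_n); last by rewrite card_le_II.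
  by rewrite (card_le_eql (card_esym card_II)).
have [f [ff injf surf]] := card_set_bijP Tk.
have /choice[h hh] : forall i : 'I_k, exists x, f x = i.
  by move=> i; have [x _ fx] := surf i (ltn_ord i); exists x.
exists h => x; exists (Ordinal (ff x I)).
by apply: injf; rewrite ?inE//; exact: hh.
Qed.

Section LowerBound.
Context (r m : nat) (d : Order.disp_t) (Z : 'I_(r + m) -> orderTopologicalType d).
Context (Zcompact : forall j : 'I_(r + m), compact [set: Z j]).
Context (Zomega1 : forall j : 'I_m,
    has_increasing_omega1_seq (Z (rshift r j)) \/
    has_decreasing_omega1_seq (Z (rshift r j))).
Context (D : forall j : 'I_r, set (Z (lshift m j))).
Context (Dcountable : forall j : 'I_r, countable (@D j)).
Context (Dnscattered : forall j : 'I_r, ~ scattered (set_type (closure (@D j)))).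
Context (Dsecond : forall i j : 'I_r,
    @second_countable (set_type (closure (@D i))) ->
    @second_countable (set_type (closure (@D j))) -> i = j).

(** Each coordinate gets one kind: omega_1-sequence ([isW]), convergent sequence ([isC]) or jumps
    ([isJ]). *)
Let sc (i : 'I_r) := `[< @second_countable (set_type (closure (@D i))) >].
Let isW (j : 'I_(r + m)) := if fintype.split j is inr _ then true else false.
Let isC (j : 'I_(r + m)) := if fintype.split j is inl i then sc i else false.
Let isJ (j : 'I_(r + m)) := if fintype.split j is inl i then ~~ sc i else false.

Let local_kind (j : 'I_(r + m)) (Kind : topologicalType -> Prop) (o : Z j) :=
  forall N, nbhs o N -> exists (Y : topologicalType) (xi : Y -> Z j),
  [/\ Kind Y, continuous xi, injective xi & forall y, N (xi y)].

Lemma base_point : exists x0 : prod_topology Z, forall j,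
  [/\ isW j -> local_kind omega1_space (x0 j),
      isC j -> local_kind (omega1_core^~ 1%N) (x0 j) &
      isJ j -> local_kind jump_space (x0 j)].
Proof.
suff h : forall j, exists o : Z j, [/\ isW j -> local_kind omega1_space o,
    isC j -> local_kind (omega1_core^~ 1%N) o & isJ j -> local_kind jump_space o].
  by exists (fun j => projT1 (cid (h j))) => j; exact: (projT2 (cid (h j))).
move=> j; rewrite /isW /isC /isJ; case: (split_ordP j) => i ->.
  rewrite /sc; case: asboolP => sci.
    have [o ho] := convergent_point (@Zcompact _) (nonscattered_infinite (@Dnscattered i)).
    by exists o; split.
  have [o ho] := jump_point (@Zcompact _) (@Dcountable i) sci.
  by exists o; split.
suff [o ho] : exists o : Z (rshift r i), local_kind omega1_space o by exists o; split.
have [[dW [W [g [oW mg]]]]|[dW [W [g [oW mg]]]]] := Zomega1 i.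
- exact: (omega1_point (@Zcompact _) oW (s := true) mg).
- exact: (omega1_point (@Zcompact _) oW (s := false) mg).
Qed.

(** Inside [U], the jump coordinates carry a jump core and the others an omega_1-core. Their product
    injects into [U], while fewer than [r + m] maps into LOTSes cannot separate its points. *)
Lemma lower_bound : exists x0 : prod_topology Z, forall U, nbhs x0 U ->
  forall J : Type, embeds_in_LOTS_product (set_type (closure U)) J ->
  ([set: 'I_(r + m)] #<= [set: J])%card.
Proof.
have [x0 hx0] := base_point; exists x0 => U nU J [dL [L [f [injf contf _]]]].
apply: contrapT => /small_type_enum[k krm [h hsurj]].
have [N [hN NU]] := nbhs_prod_box nU.
pose lW := [seq j <- enum 'I_(r + m) | isW j].
pose lC := [seq j <- enum 'I_(r + m) | isC j].
pose lJ := [seq j <- enum 'I_(r + m) | isJ j].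
have cases j : [/\ [|| isW j, isC j | isJ j], ~~ (isW j && isC j),
    ~~ (isW j && isJ j) & ~~ (isC j && isJ j)].
  by rewrite /isW /isC /isJ; case: fintype.split => // i; case: sc.
have [A [phi [cA rA]]] : exists (A : topologicalType) (phi : A -> prod_topology Z),
    omega1_core A (size lW + size lC)%N /\ realizes x0 N (lW ++ lC) phi.
  have uWC : uniq (lW ++ lC).
    rewrite cat_uniq; apply/and3P; split; try by rewrite filter_uniq ?enum_uniq.
    apply/hasPn => j.
    rewrite !mem_filter => /andP[Cj _]; apply/negP => /andP[Wj _].
    by have [_ + _ _] := cases j; rewrite Wj Cj.
  have stW i : i \in lW -> exists (Y : topologicalType) (xi : Y -> Z i),
      [/\ omega1_space Y, continuous xi, injective xi & forall y, N i (xi y)].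
    by rewrite mem_filter => /andP[Wi _]; have [/(_ Wi)/(_ _ (hN i))] := hx0 i.
  have sC : (size lC <= 1)%N.
    have uC : uniq lC by rewrite filter_uniq ?enum_uniq.
    have eqC c c' : isC c -> isC c' -> c = c'.
      rewrite /isC; case: (split_ordP c) => i -> // /asboolP h1.
      by case: (split_ordP c') => i' -> // /asboolP h2; rewrite (Dsecond h1 h2).
    have small l : uniq l -> all isC l -> (size l <= 1)%N.
      case: l => [|c [|c' l]] //= + /and3P[h1 h2 _].
      by rewrite (eqC _ _ h1 h2) inE eqxx.
    by apply: small => //; rewrite filter_all.
  have aC : all isC lC by rewrite filter_all.
  have step A Y n := @omega1_core_prod A Y n.
  (* The induction starts from a point with count 0, or from the sequence in the single coordinate
     of kind [isC] with count 1. *)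
  clearbody lC; case: lC uWC sC aC => [|c [|c' l]]// uWC _.
    move=> _; exact: (realizes_iter step uWC stW omega1_core_point (realizes_point x0 N)).
  rewrite /= andbT => Cc; have [_ /(_ Cc)/(_ _ (hN c)) [Y [xi [cY cxi ixi Nxi]]] _] := hx0 c.
  exact: (realizes_iter step uWC stW cY (realizes_one x0 cxi ixi Nxi)).
have [S [psi [cS rS]]] : exists (S : topologicalType) (psi : S -> prod_topology Z),
    jump_core S (size lJ + 0)%N /\ realizes x0 N (lJ ++ [::]) psi.
  have step A Y n := @jump_core_prod A Y n.
  apply: (realizes_iter step _ _ jump_core_point (realizes_point x0 N)).
    by rewrite cats0 filter_uniq ?enum_uniq.
  by move=> i; rewrite mem_filter => /andP[Ji _]; have [_ _ /(_ Ji)/(_ _ (hN i))] := hx0 i.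
rewrite cats0 addn0 in cS rS.
have dis : {in lJ, forall i, i \notin lW ++ lC}.
  move=> i; rewrite mem_cat !mem_filter => /andP[Ji _].
  by have [_ _ h1 h2] := cases i; move: h1 h2; rewrite Ji !andbT => /negbTE-> /negbTE->.
have [Psi [cPsi iPsi NPsi _]] : exists Psi : S * A -> prod_topology Z,
    realizes x0 N (lJ ++ lW ++ lC) Psi.
  by eexists; exact: realizes_pair dis rS rA.
have UPsi x : closure U (Psi x).
  apply: subset_closure; apply: NU => i; apply: NPsi.
  have mem_f P : (i \in [seq j <- enum 'I_(r + m) | P j]) = P i.
    by rewrite mem_filter mem_enum andbT.
  rewrite !mem_cat !mem_f.
  by have [/or3P[]-> _ _ _] := cases i; rewrite ?orbT.
pose F x : set_type (closure U) := to_set (UPsi x).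
have cF : continuous F by apply: set_type_continuous; exact: cPsi.
have [||x [y [xy fxy]]] := @core_not_injective S A (size lJ) (size lW + size lC)%N k dL
    (fun i => L (h i)) (fun i x => f (F x) (h i)) cS cA.
- move=> i a; split.
  + have /continuousP := continuous_compose (@eval_continuous _ L (h i))
      (continuous_compose contf cF).
    by move=> /(_ _ (ltz_open_lt true a)).
  + have /continuousP := continuous_compose (@eval_continuous _ L (h i))
      (continuous_compose contf cF).
    by move=> /(_ _ (ltz_open_gt true a)).
(* Every coordinate has some kind, so the three lists have at least [r + m] entries in total. *)
- apply: leq_trans krm _; rewrite !size_filter -[X in (X <= _)%N]card_ord cardE.
  rewrite -[X in (X <= _)%N](count_predT).
  elim: (enum 'I_(r + m)) => //= j l IH.
  have h1 : (1 <= isW j + isC j + isJ j)%N.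
    by have [/or3P[]-> _ _ _] := cases j; rewrite ?addn1 ?addSn.
  by rewrite (addnACA (isW j)) addnACA; exact: leq_add.
apply: xy; apply: iPsi.
have /injf/(congr1 set_val) : f (F x) = f (F y).
  apply: functional_extensionality_dep => j; have [i <-] := hsurj j; exact: fxy.
by [].
Qed.

End LowerBound.

(** * The LOTS dimension of the product *)

Lemma set_val_embedding (X : topologicalType) (A : set X) : embedding (set_val : A -> X).
Proof.
split; [exact: val_inj|exact: set_val_continuous|].
move=> _ [V oV <-]; exists V => //; apply/seteqP; split.
- by move=> _ [x Vx <-]; split=> //; exists x.
- by move=> z [Vz [x _ xz]]; exists x => //=; rewrite xz.
Qed.

Theorem theorem4p4 (r m : nat) (d : Order.disp_t)
  (Z : 'I_(r + m) -> orderTopologicalType d)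
  (Zcompact : forall j : 'I_(r + m), compact [set: Z j])
  (Zomega1 : forall j : 'I_m,
    has_increasing_omega1_seq (Z (rshift r j)) \/
    has_decreasing_omega1_seq (Z (rshift r j)))
  (D : forall j : 'I_r, set (Z (lshift m j)))
  (Dcountable : forall j : 'I_r, countable (D j))
  (Dnscattered : forall j : 'I_r, ~ scattered (set_type (closure (D j))))
  (Dsecond : forall i j : 'I_r,
    @second_countable (set_type (closure (D i))) ->
    @second_countable (set_type (closure (D j))) -> i = j) :
  Ldim_is (prod_topology Z) 'I_(r + m).
Proof.
have [x0 hx0] := lower_bound Zcompact Zomega1 Dcountable Dnscattered Dsecond.
split.
(* The whole product is a neighbourhood of every point; its inclusion uses [r + m] factors, and the
   bound at [x0] shows that fewer do not suffice. *)
- move=> x; exists setT; first exact: filterT.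
  exists 'I_(r + m); last exact: card_lexx.
  split; last by apply: hx0; exact: filterT.
  by exists d, Z, set_val; exact: set_val_embedding.
- move=> J /(_ x0)[U nU [I [emb _] IJ]].
  exact: card_le_trans (hx0 _ nU _ emb) IJ.
Qed.
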